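(* Let $K\ge 1$ and $\rho\ge 1$ be real numbers and set $$\widetilde{K} =\frac{K^2+1+\sqrt{(K^2+1)^2-4\rho (2-\rho )K^2}}{2\rho K}.$$ Then: (a) for every Banach algebra $\mathcal{A}$ satisfying the von Neumann inequality, every complex Hilbert space $H$ and every unital homomorphism $\Phi:\mathcal{A}\to\mathcal{B}(H)$, one has $\|\Phi\| = K$ if and only if $\|\Phi\|_{w_\rho}=\widetilde{K}$; (b) for every unital operator algebra $\mathcal{A}$, every complex Hilbert space $H$ and every unital homomorphism $\Phi:\mathcal{A}\to\mathcal{B}(H)$, one has $\|\Phi\|_{cb}=K$ if and only if $\|\Phi\|_{w_\rho cb}=\widetilde{K}$.
   Context: $\mathcal{B}(H)$ denotes the bounded linear operators on the complex Hilbert space $H$. Banach algebras satisfying the von Neumann inequality: a unital complex Banach algebra $\mathcal{A}$ satisfies the von Neumann inequality if for every polynomial $p\in\mathbb{C}[z]$ and every $a\in\mathcal{A}$ with $\|a\|\le1$ one has $\|p(a)\|\le\sup\{|p(z)|:z\in\mathbb{C},|z|<1\}$. Operator algebras: a unital operator algebra is a (not necessarily self-adjoint) closed unital subalgebra of $\mathcal{B}(L)$ for some Hilbert space $L$, up to completely isometric isomorphism; the matrix algebra $\mathcal{M}_n(\mathcal{A})$ of $n\times n$ matrices over $\mathcal{A}$ carries its canonical norm, inherited from $\mathcal{M}_n(\mathcal{B}(L))\simeq\mathcal{B}(L^{(n)})$, where $L^{(n)}$ is the $\ell_2$-sum of $n$ copies of $L$. Operator radii: for $\rho\ge1$, an operator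 $T\in\mathcal{B}(H)$ is in the class $\mathcal{C}_\rho$ if there exist a Hilbert space $\mathcal{H}\supset H$ and a unitary operator $U\in\mathcal{B}(\mathcal{H})$ with $T^n=\rho\,PU^nP^*$ for all $n=1,2,\dots$, where $P:\mathcal{H}\to H$ is the orthogonal projection onto $H$ (so $P^*$ is the inclusion of $H$ in $\mathcal{H}$). The operator $\rho$-radius of $A\in\mathcal{B}(H)$ is $w_\rho(A)=\inf\{\lambda>0:\lambda^{-1}A\in\mathcal{C}_\rho\}$. One has $w_1(A)=\|A\|$, and $w_2(A)$ is the numerical radius of $A$. Radii of homomorphisms: for a linear map $\Phi:\mathcal{A}\to\mathcal{B}(H)$ define (values in $[0,\infty]$) $\|\Phi\|=\sup\{\|\Phi(a)\|:a\in\mathcal{A},\|a\|\le1\}$ and $\|\Phi\|_{w_\rho}=\sup\{w_\rho(\Phi(a)):a\in\mathcal{A},\|a\|\le1\}$. If $\mathcal{A}$ is an operator algebra, let $\Phi^{(n)}:\mathcal{M}_n(\mathcal{A})\to\mathcal{M}_n(\mathcal{B}(H))\simeq\mathcal{B}(H^{(n)})$ be the map obtained by applying $\Phi$ entrywise, where $H^{(n)}$ is the $\ell_2$-sum of $n$ copies of $H$, and set $\|\Phi\|_{cb}=\sup_{n\ge1}\|\Phi^{(n)}\|$ and $\|\Phi\|_{w_\rho cb}=\sup_{n\ge1}\sup\{w_\rho(\Phi^{(n)}(A)):A\in\mathcal{M}_n(\mathcal{A}),\|A\|\le1\}$. *)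

(* Defs.v *)
From HB Require Import structures.
From mathcomp Require Import all_boot all_order all_algebra.
From mathcomp Require Import sesquilinear complex.
From mathcomp Require Import all_classical all_reals all_analysis.

Set Implicit Arguments.
Unset Strict Implicit.
Unset Printing Implicit Defensive.

Import Order.TTheory GRing.Theory Num.Theory Num.Def.
Import numFieldNormedType.Exports.

Local Open Scope classical_set_scope.
Local Open Scope complex_scope.
Local Open Scope ring_scope.

Section nrm.
Variables (R : realType) (V : normedZmodType R[i]).
Implicit Types x y : V.

(* The library norm of a complex vector space takes its values in R[i], on the
   nonnegative real axis; [nrm] is the same number read in R (see [nrmE]). *)
Definition nrm x : R := complex.Re `|x|.

Lemma nrmE x : `|x| = (nrm x)%:C.
Proof. by rewrite /nrm RRe_real// normr_real. Qed.

Lemma nrm_ge0 x : 0 <= nrm x.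
Proof. by rewrite -ler0c -nrmE. Qed.

Lemma nrmD x y : nrm (x + y) <= nrm x + nrm y.
Proof. by rewrite -lecR rmorphD/= -!nrmE ler_normD. Qed.

Lemma nrm_eq0 x : nrm x = 0 -> x = 0.
Proof. by move=> x0; apply/eqP; rewrite -normr_eq0 nrmE x0. Qed.

Lemma nrm0 : nrm (0 : V) = 0.
Proof. by rewrite /nrm normr0. Qed.

Lemma nrm_le x (r : R) : (`|x| <= r%:C) = (nrm x <= r).
Proof. by rewrite nrmE lecR. Qed.

End nrm.

Lemma nrmZ (R : realType) (V : normedModType R[i]) (a : R[i]) (x : V) :
  nrm (a *: x) = nrm a * nrm x.
Proof.
by apply: complexI; rewrite rmorphM/= -!nrmE normrZ.
Qed.

Lemma nrmC (R : realType) (r : R) : 0 <= r -> nrm (r%:C) = r.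
Proof. by move=> r0; apply: complexI; rewrite -nrmE ger0_norm// ler0c. Qed.

Section dot_norm.
Variables (C : numClosedFieldType) (U : lmodType C) (f : {dot U for conjC}).
Implicit Types u v : U.

Lemma dot_CauchySchwarz u v : `|f u v| ^+ 2 <= f u u * f v v.
Proof.
have [->|v0] := eqVneq v 0.
  by rewrite /= !linear0r normr0 expr0n.
have fv0 : 0 < f v v by rewrite dnorm_gt0.
pose a := f u v / f v v; pose w := u - a *: v.
have wv : f w v = 0.
  by rewrite linearBl/= linearZl_LR/= divfK ?subrr// gt_eqF.
have -> : u = w + a *: v by rewrite subrK.
have fwa : f w (a *: v) = 0 by rewrite linearZr_LR/= wv mulr0.
rewrite dnormD fwa conjC0 !addr0 linearDl/= wv add0r linearZl_LR/= dnormZ.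
rewrite normrM exprMn (ger0_norm (ltW fv0)) mulrDl.
rewrite [f v v ^+ 2]expr2 mulrA lerDr.
by rewrite mulr_ge0 ?dnorm_ge0.
Qed.

Lemma dot_triangle u v :
  sqrtC (f (u + v) (u + v)) <= sqrtC (f u u) + sqrtC (f v v).
Proof.
have su := sqrt_dnorm_ge0 f u; have sv := sqrt_dnorm_ge0 f v.
have suv := sqrt_dnorm_ge0 f (u + v).
rewrite -(@ler_pXn2r _ 2)// ?nnegrE ?addr_ge0// sqrtCK sqrrD !sqrtCK dnormD.
rewrite [leRHS]addrAC lerD2l.
have cs : `|f u v| <= sqrtC (f u u) * sqrtC (f v v).
  rewrite -(@ler_pXn2r _ 2)// ?nnegrE ?mulr_ge0// exprMn !sqrtCK.
  exact: dot_CauchySchwarz.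
have -> : f u v + (f u v)^*%R = 'Re (f u v) *+ 2.
  by rewrite ReE -mulr_natr divfK// pnatr_eq0.
rewrite lerMn2r/= (le_trans _ cs)//.
rewrite (le_trans (real_ler_norm (Creal_Re _)))//.
by have [] := leif_normC_Re_Creal (f u v).
Qed.

End dot_norm.

HB.mixin Record NormedModule_hasDot (R : realType) V
    & NormedModule R[i] V := {
  hdot : {dot V for (@conjC R[i])} ;
  hdotxx : forall x : V, hdot x x = `|x| ^+ 2
}.

#[short(type="preHilbertType")]
HB.structure Definition PreHilbert (R : realType) :=
  {V of NormedModule R[i] V & NormedModule_hasDot R V}.

#[short(type="hilbertType")]
HB.structure Definition Hilbert (R : realType) :=
  {V of PreHilbert R V & Complete V}.

(* As in mathcomp, [hdot] is linear in its first argument and conjugate-linear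
   in its second one. *)
Notation "''[' u , v ]" := (hdot u v) : ring_scope.


Section hilbert_theory.
Variables (R : realType) (H : hilbertType R).
Implicit Types x y : H.

Lemma hdot_nrm x : '[x, x] = (nrm x ^+ 2)%:C.
Proof. by rewrite hdotxx nrmE -rmorphXn. Qed.

End hilbert_theory.

Definition l2sum (R : realType) (H : hilbertType R) (n : nat) : Type :=
  {ffun 'I_n -> H}.

Section l2sum.
Variables (R : realType) (H : hilbertType R) (n : nat).

HB.instance Definition _ := GRing.Lmodule.on (l2sum H n).

Definition l2sum_dot (f g : l2sum H n) : R[i] := \sum_(i < n) '[f i, g i].

Let l2sum_dot_bilinear :
  bilinear_for *%R (conjC \; *%R) (l2sum_dot : l2sum H n -> l2sum H n -> R[i]).
Proof.
split=> [g a f f'|f a g g'] /=.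
- rewrite /l2sum_dot mulr_sumr -big_split/=; apply: eq_bigr => i _.
  by rewrite !ffunE linearDl/= linearZl_LR.
- rewrite /l2sum_dot mulr_sumr -big_split/=; apply: eq_bigr => i _.
  by rewrite !ffunE linearDr/= linearZr_LR.
Qed.

HB.instance Definition _ :=
  bilinear_isBilinear.Build _ _ _ _ _ _ l2sum_dot l2sum_dot_bilinear.

Let l2sum_dot_hermitian f g :
  l2sum_dot f g = (-1) ^+ false * conjC (l2sum_dot g f).
Proof.
rewrite expr0 mul1r /l2sum_dot rmorph_sum/=; apply: eq_bigr => i _.
by rewrite [LHS]hermC expr0 mul1r.
Qed.

HB.instance Definition _ :=
  isHermitianSesquilinear.Build _ _ _ _ l2sum_dot l2sum_dot_hermitian.

Let l2sum_dot_gt0 (f : l2sum H n) : f != 0 -> 0 < l2sum_dot f f.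
Proof.
have ge0 i : true -> 0 <= '[f i, f i] by rewrite hdotxx exprn_ge0.
move=> f0; rewrite lt_def (sumr_ge0 _ ge0) andbT.
apply: contra f0; rewrite (psumr_eq0 _ ge0).
move=> /allP f0; apply/eqP/ffunP => i; rewrite ffunE; apply/eqP.
have := f0 i; rewrite mem_index_enum => /(_ isT).
by rewrite hdotxx sqrf_eq0 normr_eq0.
Qed.

HB.instance Definition _ := isDotProduct.Build _ _ l2sum_dot l2sum_dot_gt0.

Let dot : {dot (l2sum H n) for (@conjC R[i])} := l2sum_dot.

Let norm (f : l2sum H n) : R[i] := sqrtC (l2sum_dot f f).

Let ler_normD f g : norm (f + g) <= norm f + norm g.
Proof. exact: (dot_triangle dot). Qed.

Let normrZ (l : R[i]) f : norm (l *: f) = `|l| * norm f.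
Proof.
rewrite /norm [l2sum_dot _ _](dnormZ dot) rootCMl ?exprn_ge0//.
by rewrite sqrCK.
Qed.

Let normr0_eq0 f : norm f = 0 -> f = 0.
Proof. by move/eqP; rewrite /norm (sqrt_dnorm_eq0 dot) => /eqP. Qed.

HB.instance Definition _ := Lmodule_isNormed.Build R[i] (l2sum H n)
  ler_normD normrZ normr0_eq0.

Let dot_norm (f : l2sum H n) : dot f f = `|f| ^+ 2.
Proof. by rewrite [`|f|]/Num.norm/= /norm sqrtCK. Qed.

HB.instance Definition _ := NormedModule_hasDot.Build R (l2sum H n) dot_norm.

Lemma l2sum_hdotE (f g : l2sum H n) : '[f, g] = \sum_(i < n) '[f i, g i].
Proof. by []. Qed.

Lemma l2sum_nrmE (f : l2sum H n) :
  nrm f ^+ 2 = \sum_(i < n) nrm (f i) ^+ 2.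
Proof.
apply: complexI; rewrite rmorphXn/= -nrmE -hdotxx l2sum_hdotE rmorph_sum/=.
by apply: eq_bigr => i _; rewrite hdot_nrm.
Qed.

Lemma l2sum_nrm_coord (f : l2sum H n) i : nrm (f i) <= nrm f.
Proof.
rewrite -(@ler_pXn2r _ 2)// ?nnegrE ?nrm_ge0// l2sum_nrmE (bigD1 i)//= lerDl.
by rewrite sumr_ge0// => j _; rewrite exprn_ge0// nrm_ge0.
Qed.

Lemma l2sum_nrm_le (f : l2sum H n) : nrm f <= \sum_(i < n) nrm (f i).
Proof.
have s0 : 0 <= \sum_(i < n) nrm (f i) by rewrite sumr_ge0// => i _; exact: nrm_ge0.
rewrite -(@ler_pXn2r _ 2)// ?nnegrE ?nrm_ge0// l2sum_nrmE expr2 mulr_suml.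
apply: ler_sum => i _; rewrite expr2 ler_wpM2l ?nrm_ge0//.
by rewrite (bigD1 i)//= lerDl sumr_ge0// => j _; exact: nrm_ge0.
Qed.

Let l2sum_complete (F : set_system (l2sum H n)) :
  ProperFilter F -> cauchy F -> cvg F.
Proof.
move=> FF /cauchyP Fc.
have cF i : cvg ((fun f : l2sum H n => f i) @ F).
  apply/cauchy_cvgP/cauchyP => e e0; have [f Ff] := Fc e e0.
  exists (f i).
  suff : F ((fun g : l2sum H n => g i) @^-1` ball (f i) e) by [].
  apply: filterS Ff => g; rewrite /preimage/= -!ball_normE /ball_/=.
  apply: le_lt_trans; have := l2sum_nrm_coord (f - g) i.
  by rewrite !ffunE -lecR -!nrmE.
apply/cvg_ex; exists ([ffun i => lim ((fun f : l2sum H n => f i) @ F)] : l2sum H n).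
apply/cvgrPdist_le => e e0; near=> f.
have le_e : \sum_(i < n) (e / n.+1%:R) <= e.
  rewrite sumr_const card_ord -[leLHS]mulr_natr -mulrA ler_piMr ?(ltW e0)//.
  by rewrite mulrC ler_pdivrMr ?ltr0n// mul1r ler_nat.
rewrite nrmE; apply: le_trans le_e; apply: (@le_trans _ _ (\sum_(i < n)
    nrm (lim ((fun f : l2sum H n => f i) @ F) - f i))%:C).
  rewrite lecR (le_trans (l2sum_nrm_le _))//.
  by apply: ler_sum => i _; rewrite !ffunE.
rewrite rmorph_sum/=; apply: ler_sum => i _; rewrite -nrmE; move: (i); near: f.
apply: filter_forall => j.
have /cvgrPdist_le := cF j.
by apply; rewrite divr_gt0// ltr0n.
Unshelve. all: by end_near. Qed.

HB.instance Definition _ := Uniform_isComplete.Build (l2sum H n) l2sum_complete.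

End l2sum.

Section bounded_operators.
Variables (R : realType) (H : hilbertType R).

Definition bounded_linear : {pred H -> H} := fun T =>
  `[< linear T /\ exists M : R, forall x, nrm (T x) <= M * nrm x >].

Record bop := Bop { bop_fun :> H -> H ; _ : bop_fun \in bounded_linear }.

HB.instance Definition _ := [isSub for bop_fun].
HB.instance Definition _ := [Choice of bop by <:].

Let bounded_linear_closed : subsemimod_closed bounded_linear.
Proof.
apply: GRing.submod_closed_semi; split.
  apply/asboolP; split; first by move=> a x y /=; rewrite scaler0 addr0.
  by exists 0 => x; rewrite mul0r nrm0.
move=> a S T /asboolP[Sl [M SM]] /asboolP[Tl [N TN]]; apply/asboolP; split.
  move=> b x y.
  have E z : (a *: S + T) z = a *: S z + T z by [].
  by rewrite !E Sl Tl !scalerDr !scalerA [b * a]mulrC addrACA.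
exists (nrm a * M + N) => x; rewrite (le_trans (nrmD _ _))// mulrDl lerD//.
by rewrite nrmZ -mulrA ler_wpM2l// nrm_ge0.
Qed.

HB.instance Definition _ :=
  GRing.SubChoice_isSubLmodule.Build _ _ bounded_linear bop bounded_linear_closed.

Implicit Types S T : bop.

Lemma bopP S T : (forall x, S x = T x) <-> S = T.
Proof. by split=> [ST|->//]; apply/val_inj/funext. Qed.

Let bop_linear T : linear T.
Proof. by have /asboolP[] := valP T. Qed.

HB.instance Definition _ T := GRing.isLinear.Build _ _ _ _ T (@bop_linear T).

Lemma bop_bounded T : exists M : R, 0 <= M /\ forall x, nrm (T x) <= M * nrm x.
Proof.
have /asboolP[_ [M TM]] := valP T; exists `|M|; split => // x /=.
by rewrite (le_trans (TM x))// ler_wpM2r ?nrm_ge0// ler_norm.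
Qed.

Lemma bopDE S T x : (S + T) x = S x + T x. Proof. by []. Qed.
Lemma bopZE a T x : (a *: T) x = a *: T x. Proof. by []. Qed.
Lemma bop0E x : (0 : bop) x = 0. Proof. by []. Qed.

Let id_bounded : idfun \in bounded_linear.
Proof. by apply/asboolP; split=> //; exists 1 => x; rewrite mul1r. Qed.

Let comp_bounded S T : S \o T \in bounded_linear.
Proof.
apply/asboolP; split; first by move=> a x y /=; rewrite !linearP.
have [M [M0 SM]] := bop_bounded S; have [N [N0 TN]] := bop_bounded T.
exists (M * N) => x; rewrite (le_trans (SM _))// -mulrA ler_wpM2l//; exact: TN.
Qed.

Definition bop_id : bop := Bop id_bounded.
Definition bop_comp S T : bop := Bop (comp_bounded S T).

Let bop_compA : associative bop_comp.
Proof. by move=> S T U; apply/bopP. Qed.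
Let bop_comp1l : left_id bop_id bop_comp.
Proof. by move=> S; apply/bopP. Qed.
Let bop_comp1r : right_id bop_id bop_comp.
Proof. by move=> S; apply/bopP. Qed.
Let bop_compDl : left_distributive bop_comp +%R.
Proof. by move=> S T U; apply/bopP. Qed.
Let bop_compDr : right_distributive bop_comp +%R.
Proof. by move=> S T U; apply/bopP => x; exact: (linearD S (T x) (U x)). Qed.

(* B(H) is the zero ring when H = 0, hence PzRing. *)
HB.instance Definition _ := GRing.Zmodule_isPzRing.Build bop
  bop_compA bop_comp1l bop_comp1r bop_compDl bop_compDr.

Lemma bopME S T x : (S * T) x = S (T x). Proof. by []. Qed.
Lemma bop1E x : (1 : bop) x = x. Proof. by []. Qed.

Definition opnorm T : R := sup [set nrm (T x) | x in [set x : H | nrm x <= 1]].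

Let opnorm_has_sup T : has_sup [set nrm (T x) | x in [set x : H | nrm x <= 1]].
Proof.
split; first by exists (nrm (T 0)); exists 0 => //=; rewrite nrm0.
have [M [M0 TM]] := bop_bounded T.
by exists M => _ [x /= x1 <-]; rewrite (le_trans (TM x))// ler_piMr.
Qed.

Lemma opnorm_ge0 T : 0 <= opnorm T.
Proof.
rewrite (le_trans (nrm_ge0 (T 0)))//; apply: sup_upper_bound => //.
by exists 0 => //=; rewrite nrm0.
Qed.

Lemma opnorm_nrm T x : nrm (T x) <= opnorm T * nrm x.
Proof.
have [x0|x0] := eqVneq (nrm x) 0.
  by rewrite x0 (nrm_eq0 x0) linear0 nrm0 mulr0.
have {}x0 : 0 < nrm x by rewrite lt_def x0 nrm_ge0.
rewrite -ler_pdivrMr// mulrC.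
have -> : (nrm x)^-1 * nrm (T x) = nrm (T ((nrm x)^-1%:C *: x)).
  by rewrite linearZ/= nrmZ nrmC// invr_ge0 ltW.
apply: sup_upper_bound => //; exists ((nrm x)^-1%:C *: x) => //=.
by rewrite nrmZ nrmC ?invr_ge0 ?(ltW x0)// mulVf ?gt_eqF.
Qed.

Lemma opnorm_le T (M : R) : 0 <= M ->
  (forall x, nrm (T x) <= M * nrm x) -> opnorm T <= M.
Proof.
move=> M0 TM; apply: ge_sup; first by case: (opnorm_has_sup T).
by move=> _ [x /= x1 <-]; rewrite (le_trans (TM x))// ler_piMr.
Qed.

Let norm T : R[i] := (opnorm T)%:C.

Let ler_normD S T : norm (S + T) <= norm S + norm T.
Proof.
rewrite -rmorphD/= lecR opnorm_le ?addr_ge0 ?opnorm_ge0// => x.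
by rewrite bopDE (le_trans (nrmD _ _))// mulrDl lerD// opnorm_nrm.
Qed.

Let opnormZ_le (a : R[i]) T : opnorm (a *: T) <= nrm a * opnorm T.
Proof.
rewrite opnorm_le ?mulr_ge0 ?opnorm_ge0 ?nrm_ge0// => x.
by rewrite bopZE nrmZ -mulrA ler_wpM2l ?nrm_ge0// opnorm_nrm.
Qed.

Let normrZ (a : R[i]) T : norm (a *: T) = `|a| * norm T.
Proof.
rewrite nrmE -rmorphM/=; congr (_%:C); apply/eqP.
rewrite eq_le opnormZ_le/=.
have [->|a0] := eqVneq a 0; first by rewrite nrm0 mul0r opnorm_ge0.
have na0 : 0 < nrm a.
  by rewrite lt_def nrm_ge0 andbT; apply: contra a0 => /eqP/nrm_eq0->.
have := opnormZ_le a^-1 (a *: T); rewrite scalerA mulVf// scale1r.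
have -> : nrm a^-1 = (nrm a)^-1.
  by apply: complexI; rewrite fmorphV/= -!nrmE normfV.
by rewrite mulrC ler_pdivlMr// mulrC.
Qed.

Let normr0_eq0 T : norm T = 0 -> T = 0.
Proof.
move=> /complexI T0; apply/bopP => x; apply: nrm_eq0; apply/eqP.
by rewrite eq_le nrm_ge0 andbT (le_trans (opnorm_nrm _ _))// T0 mul0r.
Qed.

HB.instance Definition _ :=
  Lmodule_isNormed.Build R[i] bop ler_normD normrZ normr0_eq0.

Lemma bop_nrmE T : nrm T = opnorm T. Proof. by []. Qed.

End bounded_operators.

Notation "''B' ( H )" := (bop H) (at level 8, format "''B' ( H )") : type_scope.

Section operators.
Variables (R : realType) (H : hilbertType R).

Definition is_adjoint (T S : 'B(H)) := forall x y, '[T x, y] = '[x, S y].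

Definition unitary (U : 'B(H)) :=
  exists2 V, is_adjoint U V & U * V = 1 /\ V * U = 1.

End operators.

Section radius.
Variables (R : realType) (H : hilbertType R).
Implicit Types T : 'B(H).

(* The inclusion of H in the larger space [E] is an isometric linear map [J];
   [P] is the orthogonal projection onto J(H), with its values read in H. *)
Definition class_C (rho : R) T :=
  exists (E : hilbertType R) (J : {linear H -> E}) (P : E -> H) (U : 'B(E)),
    [/\ forall x y, '[J x, J y] = '[x, y],
        forall z x, '[z - J (P z), J x] = 0,
        unitary U &
        forall n, (0 < n)%N -> forall x, (T ^+ n) x = rho%:C *: P ((U ^+ n) (J x))].

Definition op_radius (rho : R) T : \bar R :=
  ereal_inf [set l%:E | l in [set l : R | 0 < l /\ class_C rho (l^-1%:C *: T)]].

End radius.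

Section ampliation.
Variables (R : realType) (H : hilbertType R) (n : nat).

Let mxop_fun (M : 'M['B(H)]_n) (f : l2sum H n) : l2sum H n :=
  [ffun i => \sum_(j < n) M i j (f j)].

Let mxop_bounded M : mxop_fun M \in @bounded_linear R (l2sum H n).
Proof.
apply/asboolP; split.
  move=> a f g; apply/ffunP => i; rewrite !ffunE scaler_sumr -big_split/=.
  by apply: eq_bigr => j _; rewrite !ffunE linearP.
exists (\sum_(i < n) \sum_(j < n) nrm (M i j)) => f.
rewrite (le_trans (l2sum_nrm_le _))// mulr_suml; apply: ler_sum => i _.
rewrite ffunE mulr_suml.
apply: (@le_trans _ _ (\sum_(j < n) nrm (M i j (f j)))).
  elim/big_ind2 : _ => [|a b c d ab cd|//]; first by rewrite nrm0.
  by rewrite (le_trans (nrmD _ _))// lerD.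
apply: ler_sum => j _; rewrite (le_trans (opnorm_nrm _ _))//.
by apply: ler_wpM2l; [exact: opnorm_ge0|exact: l2sum_nrm_coord].
Qed.

(* The identification of M_n(B(H)) with B(H^(n)). *)
Definition mxop (M : 'M['B(H)]_n) : 'B(l2sum H n) := Bop (mxop_bounded M).

Lemma mxopE M f i : mxop M f i = \sum_(j < n) M i j (f j).
Proof. by rewrite ffunE. Qed.

End ampliation.

(* [GRing.Algebra] excludes the zero algebra, whose only unital homomorphism
   into some B(H) has H = 0. No normalization of the norm of 1 is imposed: the
   von Neumann inequality for p = 1 forces it to be 1.
   Hierarchy-Builder does not accept a structure joining rings and normed
   modules. The norm of a normed algebra [A] is therefore a separate operation,
   and [normed A] is [A] seen as a normed module for that norm. *)
HB.mixin Record Algebra_isNormed (R : realType) A & GRing.Algebra R[i] A := {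
  anorm : A -> R ;
  anormD : forall x y : A, anorm (x + y) <= anorm x + anorm y ;
  anormZ : forall (a : R[i]) (x : A), anorm (a *: x) = nrm a * anorm x ;
  anorm_eq0 : forall x : A, anorm x = 0 -> x = 0 ;
  anormM : forall x y : A, anorm (x * y) <= anorm x * anorm y
}.

#[short(type="normedAlgType")]
HB.structure Definition NormedAlgebra (R : realType) :=
  {A of GRing.Algebra R[i] A & Algebra_isNormed R A}.

Definition normed (R : realType) (A : normedAlgType R) : Type := A.

Section normed.
Variables (R : realType) (A : normedAlgType R).

HB.instance Definition _ := GRing.Lmodule.on (normed A).

Let norm (x : normed A) : R[i] := (anorm x)%:C.

Let ler_normD x y : norm (x + y) <= norm x + norm y.
Proof. by rewrite -rmorphD/= lecR anormD. Qed.

Let normrZ (a : R[i]) x : norm (a *: x) = `|a| * norm x.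
Proof. by rewrite nrmE -rmorphM/= -anormZ. Qed.

Let normr0_eq0 x : norm x = 0 -> x = 0.
Proof. by move=> /complexI/anorm_eq0. Qed.

HB.instance Definition _ :=
  Lmodule_isNormed.Build R[i] (normed A) ler_normD normrZ normr0_eq0.

Lemma normed_nrmE (x : normed A) : nrm x = anorm x. Proof. by []. Qed.

End normed.

HB.mixin Record NormedAlgebra_isComplete (R : realType) A
    & NormedAlgebra R A := {
  anorm_complete : forall F : set_system (normed A),
    ProperFilter F -> cauchy F -> cvg F
}.

#[short(type="banachAlgType")]
HB.structure Definition BanachAlgebra (R : realType) :=
  {A of NormedAlgebra R A & NormedAlgebra_isComplete R A}.

HB.instance Definition _ (R : realType) (A : banachAlgType R) :=
  Uniform_isComplete.Build (normed A) (@anorm_complete R A).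

Definition von_neumann_ineq (R : realType) (A : banachAlgType R) :=
  forall (p : {poly R[i]}) (a : A), anorm a <= 1 ->
    ((anorm (horner_alg a p))%:E <=
       ereal_sup [set (nrm p.[z])%:E | z in [set z : R[i] | (nrm z < 1)%R]])%E.

(* A closed unital subalgebra of B(L), up to completely isometric isomorphism:
   an algebra given with a faithful unital representation on L whose range is
   closed in norm, the norm of M_n(A) being the one induced by the embedding of
   M_n(A) in M_n(B(L)) = B(L^(n)). *)
Record opAlg (R : realType) := OpAlg {
  opalg_alg :> algType R[i] ;
  opalg_space : hilbertType R ;
  opalg_incl : {lrmorphism opalg_alg -> 'B(opalg_space)} ;
  opalg_incl_inj : injective opalg_incl ;
  opalg_incl_closed : closed (range opalg_incl)
}.

Definition opalg_mxnorm (R : realType) (A : opAlg R) n (M : 'M[A]_n) : R :=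
  nrm (mxop (map_mx (opalg_incl A) M)).

Section hom_norms.
Variables (R : realType) (A : banachAlgType R) (H : hilbertType R).
Variable Phi : A -> 'B(H).

Definition hom_norm : \bar R :=
  ereal_sup [set (nrm (Phi a))%:E | a in [set a : A | anorm a <= 1]].

Definition hom_radius (rho : R) : \bar R :=
  ereal_sup [set op_radius rho (Phi a) | a in [set a : A | anorm a <= 1]].

End hom_norms.

Section hom_cbnorms.
Variables (R : realType) (A : opAlg R) (H : hilbertType R).
Variable Phi : A -> 'B(H).

Definition ampliation n (M : 'M[A]_n) : 'B(l2sum H n) := mxop (map_mx Phi M).

Definition hom_cbnorm : \bar R :=
  ereal_sup [set ereal_sup [set (nrm (ampliation M))%:E
                           | M in [set M : 'M[A]_n | opalg_mxnorm M <= 1]]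
            | n in [set n | (0 < n)%N]].

Definition hom_cbradius (rho : R) : \bar R :=
  ereal_sup [set ereal_sup [set op_radius rho (ampliation M)
                           | M in [set M : 'M[A]_n | opalg_mxnorm M <= 1]]
            | n in [set n | (0 < n)%N]].

End hom_cbnorms.

(* Main.v *)
(* Both suprema are controlled by disc automorphisms.  If [T] runs through the
   image of the unit ball, so does [S = (T - a) (1 - a^* T)^-1], up to polynomial
   approximation.  Writing [|S x| <= K |x|] at [x = (1 - a^* T) y] gives
   [K^2 |(1 - a^* T) y|^2 - |(T - a) y|^2 >= 0], and for a suitable [|a|] this is,
   up to a positive factor, the Sz.-Nagy--Foias inequality
   [rho k^2 |y|^2 - 2 (rho - 1) k Re <z T y, y> + (rho - 2) |T y|^2 >= 0], |z| = 1,
   characterizing [w_rho(T) <= k], where [K + 1/K = rho k + (2 - rho)/k].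
   Since the automorphism is inverted by another one, the same identity also
   leads from [w_rho <= k] back to the norm bound [K].

   The rho-dilation of an operator [A] satisfying a strict form of the
   inequality is the bilateral shift on l^2(Z, H), renormed by the equivalent
   form [|g|^2 - 2 (1 - 1/rho) Re <B g, g> + (1 - 2/rho) |B g|^2], with
   [B = A (x) shift]; [H] is embedded by [x |-> (A^n x)_{n >= 0}]. *)
Require Import Defs.
From HB Require Import structures.
From mathcomp Require Import all_boot all_order all_algebra.
From mathcomp Require Import sesquilinear complex.
From mathcomp Require cyclic separable cyclotomic.
From mathcomp Require Import all_classical all_reals all_analysis.
From mathcomp Require Import zify ring lra.

Set Implicit Arguments.
Unset Strict Implicit.
Unset Printing Implicit Defensive.

Import Order.TTheory GRing.Theory Num.Theory Num.Def.
Import numFieldNormedType.Exports.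

Local Open Scope classical_set_scope.
Local Open Scope complex_scope.
Local Open Scope ring_scope.

(** * Norms and real parts of inner products *)

(** Inverses such as (1 - r T)^-1 are never formed, since the von Neumann inequality speaks of
    polynomials. Each automorphism is replaced by a truncated geometric sum, whose sup norm on the
    disc is at most 1 + r^(n+1); dividing by this number stays in the unit ball, and evaluation at
    vectors x - r T x leaves an error of order r^(n+1). The dilation needs two margins: a coercive
    form, so that the new norm is equivalent to that of l^2, and square-summable orbits. Both come
    from replacing K by a slightly larger K', hence k by some l > 1. What is proved is therefore an
    equivalence of upper bounds for all related pairs, up to e; monotonicity of the relation turns
    it into an equivalence of equalities. The relation is used only from 1 on, so the value at the
    unit element enters, and H = 0 is treated apart. *)

Section nrm_theory.
Variables (R : realType).

Lemma nrmM (a b : R[i]) : nrm (a * b) = nrm a * nrm b.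
Proof. by apply: complexI; rewrite rmorphM/= -!nrmE normrM. Qed.

Lemma nrm1 : nrm (1 : R[i]) = 1.
Proof. by rewrite -(nrmC ler01). Qed.

Lemma nrmX (a : R[i]) n : nrm (a ^+ n) = nrm a ^+ n.
Proof. by elim: n => [|n IHn]; rewrite ?nrm1// !exprS nrmM IHn. Qed.

Lemma nrmN (V : normedZmodType R[i]) (x : V) : nrm (- x) = nrm x.
Proof. by rewrite /nrm normrN. Qed.

Lemma nrm_distC (V : normedZmodType R[i]) (x y : V) : nrm (x - y) = nrm (y - x).
Proof. by rewrite -nrmN opprB. Qed.

Lemma nrmB (V : normedZmodType R[i]) (x y : V) : nrm (x - y) <= nrm x + nrm y.
Proof. by rewrite (le_trans (nrmD _ _))// nrmN. Qed.

Lemma nrmB_ge (V : normedZmodType R[i]) (x y : V) :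
  nrm x - nrm y <= nrm (x - y).
Proof. by rewrite lerBlDr (le_trans _ (nrmD _ _))// subrK. Qed.

Lemma nrm_dist (V : normedZmodType R[i]) (x y : V) :
  `|nrm x - nrm y| <= nrm (x - y).
Proof. by rewrite ler_norml lerNl opprB {1}nrm_distC !nrmB_ge. Qed.

Lemma Re_nrm (a : R[i]) : `|complex.Re a| <= nrm a.
Proof.
case: a => a b; rewrite /nrm normc_def/= -sqrtr_sqr.
by rewrite ler_sqrt ?lerDl ?sqr_ge0 ?addr_ge0// sqr_ge0.
Qed.

Lemma ReD (a b : R[i]) : complex.Re (a + b) = complex.Re a + complex.Re b.
Proof. by case: a; case: b. Qed.

Lemma ReN (a : R[i]) : complex.Re (- a) = - complex.Re a.
Proof. by case: a. Qed.

Lemma Re_conj (a : R[i]) : complex.Re a^*%C = complex.Re a.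
Proof. by case: a. Qed.

Lemma ReZ (a : R) (b : R[i]) : complex.Re (a%:C * b) = a * complex.Re b.
Proof. by case: b => b c /=; rewrite mul0r subr0. Qed.

Lemma Re_sum I (r : seq I) (P : pred I) (F : I -> R[i]) :
  complex.Re (\sum_(i <- r | P i) F i) = \sum_(i <- r | P i) complex.Re (F i).
Proof. by elim/big_rec2 : _ => //= i a b _ <-; rewrite ReD. Qed.

Lemma mulCJ (a : R[i]) : a * a^*%C = (nrm a ^+ 2)%:C.
Proof. by rewrite rmorphXn/= -nrmE; exact/esym/normCK. Qed.

End nrm_theory.

Section rdot.
Variables (R : realType) (H : preHilbertType R).
Implicit Types (x y z : H) (a : R[i]).

Definition rdot x y : R := complex.Re '[x, y].

Lemma hdotC x y : '[y, x] = ('[x, y])^*%C.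
Proof. by rewrite hermC expr0 mul1r. Qed.

Lemma hdot_nrm2 x : '[x, x] = (nrm x ^+ 2)%:C.
Proof. by rewrite hdotxx nrmE -rmorphXn. Qed.

Lemma rdotxx x : rdot x x = nrm x ^+ 2.
Proof. by rewrite /rdot hdot_nrm2. Qed.

Lemma rdotC x y : rdot x y = rdot y x.
Proof. by rewrite /rdot [in RHS]hdotC Re_conj. Qed.

Lemma rdotDl x y z : rdot (x + y) z = rdot x z + rdot y z.
Proof. by rewrite /rdot linearDl ReD. Qed.

Lemma rdotDr x y z : rdot z (x + y) = rdot z x + rdot z y.
Proof. by rewrite !(rdotC z) rdotDl. Qed.

Lemma rdotNl x y : rdot (- x) y = - rdot x y.
Proof. by rewrite /rdot linearNl ReN. Qed.

Lemma rdotNr x y : rdot x (- y) = - rdot x y.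
Proof. by rewrite !(rdotC x) rdotNl. Qed.

Lemma rdot0r x : rdot x 0 = 0.
Proof. by rewrite /rdot linear0r. Qed.

Lemma rdot0l x : rdot 0 x = 0.
Proof. by rewrite rdotC rdot0r. Qed.

Lemma rdotZl (r : R) x y : rdot (r%:C *: x) y = r * rdot x y.
Proof. by rewrite /rdot linearZl_LR/= ReZ. Qed.

Lemma rdotZr (r : R) x y : rdot x (r%:C *: y) = r * rdot x y.
Proof. by rewrite !(rdotC x) rdotZl. Qed.

Lemma rdotZZ a x y : rdot (a *: x) (a *: y) = nrm a ^+ 2 * rdot x y.
Proof. by rewrite /rdot linearZl_LR linearZr_LR/= mulrA mulCJ ReZ. Qed.

Definition rdotE := (rdotDl, rdotDr, rdotNl, rdotNr).

Lemma nrm_sqrD x y : nrm (x + y) ^+ 2 = nrm x ^+ 2 + 2 * rdot x y + nrm y ^+ 2.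
Proof. by rewrite -!rdotxx !rdotE [rdot y x]rdotC; ring. Qed.

Lemma nrm_sqrB x y : nrm (x - y) ^+ 2 = nrm x ^+ 2 - 2 * rdot x y + nrm y ^+ 2.
Proof. by rewrite nrm_sqrD rdotNr nrmN; ring. Qed.

Lemma nrm_hdot x y : nrm ('[x, y] : R[i]) <= nrm x * nrm y.
Proof.
rewrite -(@ler_pXn2r _ 2)// ?nnegrE ?mulr_ge0 ?nrm_ge0//.
rewrite -lecR rmorphXn/= -nrmE exprMn rmorphM/= -!hdot_nrm2.
exact: dot_CauchySchwarz.
Qed.

Lemma rdot_le x y : `|rdot x y| <= nrm x * nrm y.
Proof. exact: le_trans (Re_nrm _) (nrm_hdot _ _). Qed.

End rdot.

Lemma Im_hdot (R : realType) (H : preHilbertType R) (x y : H) :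
  complex.Im '[x, y] = rdot x ('i%C *: y).
Proof.
rewrite /rdot linearZr_LR/=; case: '[x, y] => a b /=.
by rewrite mul0r mulN1r opprK add0r.
Qed.

Lemma hdot_eq (R : realType) (H E : preHilbertType R) (x y : H) (x' y' : E) :
  rdot x y = rdot x' y' -> rdot x ('i%C *: y) = rdot x' ('i%C *: y') ->
  '[x, y] = '[x', y'].
Proof.
rewrite -!Im_hdot => re im.
by apply/eqP; rewrite eq_complex im eqxx andbT; apply/eqP.
Qed.

Lemma nrm_isometry (R : realType) (H E : preHilbertType R) (J : H -> E) x :
  (forall x y, '[J x, J y] = '[x, y]) -> nrm (J x) = nrm x.
Proof.
move=> Jiso; apply/eqP; rewrite -(@eqrXn2 _ 2)// ?nrm_ge0//.
by rewrite -!rdotxx /rdot Jiso.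
Qed.

(** * Operators of class C_rho satisfy the Sz.-Nagy--Foias inequality *)

(** Limit device for the truncated series below: the cut leaves an error of order s^(N+1), and [b]
    is arbitrary, so crude bounds of the error suffice. *)
Lemma ge0_geometric (R : realType) (a b s : R) :
  0 <= s < 1 -> (forall N, 0 <= a + b * s ^+ N.+1) -> 0 <= a.
Proof.
move=> /andP[s0 s1] ab.
have s_cvg : a + b * s ^+ n.+1 @[n --> \oo] --> a.
  rewrite -[X in _ --> X]addr0 -[X in _ --> _ + X](mulr0 b).
  apply: cvgD; first exact: cvg_cst.
  apply: cvgMl_tmp; rewrite cvg_shiftS/=.
  by apply: cvg_expr; rewrite ger0_norm.
rewrite -(cvg_lim _ s_cvg)//; apply: limr_ge; first by apply/cvg_ex; exists a.
exact: nearW.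
Qed.

Section rform.
Variables (R : realType) (H : preHilbertType R).
Implicit Types (x y : H) (rho : R).

(** The form of Sz.-Nagy and Foias at k = 1, with y for z T x. At rho = 1 it is |x|^2 - |y|^2
    (contractions), at rho = 2 it is 2 (|x|^2 - Re <y, x>) (numerical radius). *)
Definition rform rho x y :=
  rho * nrm x ^+ 2 - 2 * (rho - 1) * rdot y x + (rho - 2) * nrm y ^+ 2.

(** With y = (1 - z T) x the right side is Re <((rho - 2) + 2 (1 - z T)^-1) y, y>: positivity of a
    resolvent, the shape in which a dilation yields it. *)
Lemma rformB rho x y :
  rform rho x (x - y) = (rho - 2) * nrm y ^+ 2 + 2 * rdot x y.
Proof.
by rewrite /rform nrm_sqrB rdotDl rdotNl rdotxx [rdot y x]rdotC; ring.
Qed.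

End rform.

Section unitary.
Variables (R : realType) (H : hilbertType R).
Implicit Types (T : 'B(H)) (x y : H).

Lemma unitary_nrm T x : unitary T -> nrm (T x) = nrm x.
Proof.
case=> V TV [_ VT]; apply/eqP; rewrite -(@eqrXn2 _ 2)// ?nrm_ge0//.
by rewrite -!rdotxx /rdot TV -bopME VT.
Qed.

Lemma unitaryX_nrm T n x : unitary T -> nrm ((T ^+ n) x) = nrm x.
Proof. by move=> uT; elim: n => // n IHn; rewrite exprS bopME unitary_nrm. Qed.

End unitary.

Section class_C.
Variables (R : realType) (H : hilbertType R).
Implicit Types (T : 'B(H)) (x y : H).

Lemma class_C_nrmX rho T n x :
  1 <= rho -> class_C rho T -> nrm ((T ^+ n) x) <= rho * nrm x.
Proof.
move=> rho1 [E [J [P [U [Jiso JP Uu TU]]]]].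
case: n => [|n]; first by rewrite expr0 bop1E ler_peMl ?nrm_ge0.
set v := _ x; have [->|v0] := eqVneq (nrm v) 0.
  by rewrite mulr_ge0 ?nrm_ge0// (le_trans _ rho1).
have {}v0 : 0 < nrm v by rewrite lt_def v0 nrm_ge0.
have nJ y : nrm (J y) = nrm y := nrm_isometry y Jiso.
rewrite -(ler_pM2r v0) -expr2 -rdotxx {1}/v TU// rdotZl -mulrA ler_wpM2l//.
  exact: le_trans rho1.
set u := (U ^+ _) _; have := JP u v; rewrite linearBl/= Jiso => /subr0_eq uv.
rewrite /rdot -uv (le_trans (ler_norm _))// (le_trans (rdot_le _ _))//.
by rewrite /u (unitaryX_nrm _ _ Uu) !nJ.
Qed.

(** For U unitary and |z| < 1, Re (1 - z U)^-1 >= 1/2. Compressed to H, rho times this resolvent is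
    (rho - 1) + (1 - z T)^-1, because T^n = rho P U^n holds only from n = 1 on. Comparing the two
    gives the form as written in [rformB]. *)
Lemma class_C_rform rho T z x : 1 <= rho -> class_C rho T -> nrm z < 1 ->
  0 <= rform rho x (z *: T x).
Proof.
move=> rho1 CT z1; have [E [J [P [U [Jiso JP Uu TU]]]]] := CT.
have nJ y : nrm (J y) = nrm y := nrm_isometry y Jiso.
pose y := x - z *: T x; pose s := nrm z.
(* [w N] is the Neumann series of (1 - z U)^-1 J y cut at N terms; [v N] is the defect left by the
   cut ([we]). *)
pose v n := z ^+ n *: (U ^+ n) (J y); pose w N := \sum_(n < N) v n.
have nv n : nrm (v n) = s ^+ n * nrm y by rewrite nrmZ nrmX unitaryX_nrm// nJ.
have we N : w N - z *: U (w N) = J y - v N.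
  rewrite /w; elim: N => [|N IHN].
    by rewrite big_ord0 linear0 scaler0 subr0 /v !expr0 bop1E scale1r subrr.
  rewrite big_ord_recr/= linearD scalerDr opprD addrACA IHN.
  by rewrite /v !exprS bopME -scalerA -[z ^+ N *: U _](linearZ_LR U)/= subrKA.
have wJ N : rho * rdot (w N.+1) (J y) =
    (rho - 1) * nrm y ^+ 2 + rdot (x - z ^+ N.+1 *: (T ^+ N.+1) x) y.
  elim: N => [|N IHN].
    rewrite /w big_ord1 /v !expr0 bop1E scale1r rdotxx nJ !expr1 rdotxx.
    by ring.
  rewrite /w big_ord_recr/= rdotDl mulrDr IHN.
  have -> : rho * rdot (v N.+1) (J y) = rdot (z ^+ N.+1 *: (T ^+ N.+1) y) y.
    rewrite TU// scalerA [_ * rho%:C]mulrC -scalerA rdotZl; congr (_ * _).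
    rewrite /rdot !linearZl_LR; congr (complex.Re (_ * _)).
    by have /eqP := JP ((U ^+ N.+1) (J y)) y;
      rewrite linearBl/= Jiso subr_eq0 => /eqP.
  have -> : (T ^+ N.+1) y = (T ^+ N.+1) x - z *: (T ^+ N.+2) x.
    by rewrite linearB linearZ/= -bopME -exprSr.
  by rewrite -addrA -rdotDl scalerBr scalerA -exprSr subrKA.
have s0 : 0 <= s := nrm_ge0 z.
have -> : z *: T x = x - y by rewrite opprB addrC subrK.
(* The three terms bound the errors from <W, V>, where |W| <= 2 |y| / (1 - s), from <J y, V>, and
   from the remainder T^(N+1) x, where |T^(N+1) x| <= rho |x|. *)
rewrite rformB; apply: (@ge0_geometric _ _
  (4 * rho * nrm y ^+ 2 / (1 - s) + 2 * rho * nrm y ^+ 2 + 2 * rho * nrm x * nrm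
    y) s).
  by rewrite s0.
move=> N; set q := s ^+ _; have q0 : 0 <= q by rewrite exprn_ge0.
have q1 : q <= 1 by rewrite exprn_ile1 // ltW.
set W := w N.+1; set V := v N.+1; have nV : nrm V = q * nrm y := nv _.
have y0 := nrm_ge0 y.
have nW : nrm W <= 2 * nrm y / (1 - s).
  rewrite ler_pdivlMr ?subr_gt0// mulrBr mulr1 [_ * s]mulrC.
  have <- : nrm (z *: U W) = s * nrm W by rewrite nrmZ unitary_nrm.
  rewrite (le_trans (nrmB_ge _ _))// we (le_trans (nrmB _ _))// nJ nV.
  by nra.
(* |z U W| <= |W| with z U W = W - (J y - V): this is Re (1 - z U)^-1 >= 1/2. *)
have H1 : nrm (J y - V) ^+ 2 <= 2 * rdot W (J y - V).
  rewrite -we -/W -subr_ge0; set zW := _ *: _.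
  have : nrm zW ^+ 2 <= nrm W ^+ 2.
    rewrite lerXn2r ?nnegrE ?nrm_ge0// nrmZ unitary_nrm//.
    by rewrite ler_piMl ?nrm_ge0// ltW.
  by rewrite nrm_sqrB rdotDr rdotNr rdotxx; lra.
have /ler_normlP[H2 _] := rdot_le W V.
have /ler_normlP[_ H3] := rdot_le (J y) V.
have := rdot_le (z ^+ N.+1 *: (T ^+ N.+1) x) y.
rewrite nrmZ nrmX -/s -/q => /ler_normlP[H4 _].
have H5 : nrm ((T ^+ N.+1) x) <= rho * nrm x by apply: class_C_nrmX.
have H6 := wJ N; rewrite -/W rdotDl rdotNl in H6.
have H7 : q * nrm ((T ^+ N.+1) x) * nrm y <= q * (rho * nrm x) * nrm y.
  by rewrite ler_wpM2r// ler_wpM2l.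
have H8 : nrm W * nrm V <= (2 * nrm y / (1 - s)) * (q * nrm y).
  by rewrite nV ler_wpM2r// mulr_ge0.
rewrite nrm_sqrB nV nJ rdotDr rdotNr in H1; rewrite nV nJ in H3.
have H9 : 0 <= (q * nrm y) ^+ 2 by rewrite sqr_ge0.
have H10 : nrm y ^+ 2 <= 2 * rdot W (J y)
    + 2 * (2 * nrm y / (1 - s) * (q * nrm y)) + 2 * (nrm y * (q * nrm y)).
  by lra.
have := ler_wpM2l (le_trans ler01 rho1) H10.
have -> : rho * (2 * rdot W (J y) + 2 * (2 * nrm y / (1 - s) * (q * nrm y))
      + 2 * (nrm y * (q * nrm y))) =
    2 * (rho * rdot W (J y))
      + (4 * rho * nrm y ^+ 2 / (1 - s) + 2 * rho * nrm y ^+ 2) * q by ring.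
by rewrite H6; lra.
Qed.

End class_C.

(** * Hilbert spaces from complete real inner products *)

Lemma natSinv_le (R : realType) (e : R) : 0 < e ->
  exists N, forall n, (N <= n)%N -> n.+1%:R^-1 <= e.
Proof.
move=> e0; have [N _ NP] := near_infty_natSinv_lt (PosNum e0).
by exists N => n Nn; rewrite ltW//; exact: NP.
Qed.

(* A complex inner product is determined by its real part, a real inner product
   invariant under multiplication by 'i: [<x, y> = q x y + i q x (i y)]. *)
Record real_dot (R : realType) (U : lmodType R[i]) := RealDot {
  rdfun :> U -> U -> R ;
  rdfunC : forall x y, rdfun x y = rdfun y x ;
  rdfunD : forall x y z, rdfun (x + y) z = rdfun x z + rdfun y z ;
  rdfunZ : forall (a : R) x y, rdfun (a%:C *: x) y = a * rdfun x y ;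
  rdfuni : forall x y, rdfun ('i *: x) ('i *: y) = rdfun x y ;
  rdfun_gt0 : forall x, x != 0 -> 0 < rdfun x x ;
  rdfun_complete : forall u : nat -> U,
    (forall e, 0 < e -> exists N, forall m n, (N <= m)%N -> (N <= n)%N ->
       rdfun (u m - u n) (u m - u n) <= e) ->
    exists l, forall e, 0 < e -> exists N, forall n, (N <= n)%N ->
      rdfun (l - u n) (l - u n) <= e
}.

Definition dotspace (R : realType) (U : lmodType R[i]) (q : real_dot U) : Type :=
  U.

Section dotspace.
Variables (R : realType) (U : lmodType R[i]) (q : real_dot U).
Local Notation E := (dotspace q).

HB.instance Definition _ := GRing.Lmodule.on E.

Definition dotspace_dot (x y : E) : R[i] := q x y +i* q x ('i *: (y : U)).

Let qii x : 'i *: ('i *: x) = - x :> U.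
Proof. by rewrite scalerA -expr2 sqr_i scaleN1r. Qed.

Let qNl x y : q (- x) y = - q x y.
Proof. by rewrite -scaleN1r -[-1](rmorphN1 (real_complex R)) rdfunZ mulN1r. Qed.

Let qil x y : q ('i *: x) y = - q x ('i *: y).
Proof. by rewrite -rdfuni qii qNl. Qed.

Let qZ (a : R[i]) x y : q (a *: x) y =
  complex.Re a * q x y - complex.Im a * q x ('i *: y).
Proof.
rewrite {1}[a]complexE scalerDl mulrC -scalerA rdfunD !rdfunZ qil.
by rewrite mulrN.
Qed.

Let dotP (a : R[i]) (x y z : E) :
  dotspace_dot (a *: x + y) z = a * dotspace_dot x z + dotspace_dot y z.
Proof.
apply/eqP; rewrite eq_complex /dotspace_dot !rdfunD/=.
rewrite !(qZ a x) qii ![q x (- _)]rdfunC qNl ![q _ x]rdfunC.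
by case: a => a b /=; rewrite mulrN opprK eqxx/= addrC.
Qed.

Let dotC (x y : E) : dotspace_dot x y = (dotspace_dot y x)^*%C.
Proof.
rewrite /dotspace_dot/= -qil; congr (_ +i* _); exact: rdfunC.
Qed.

Let dot_bilinear : bilinear_for *%R (conjC \; *%R)
  (dotspace_dot : E -> E -> R[i]).
Proof.
split=> [z|z] a x y; first exact: dotP.
rewrite [LHS]dotC dotP [LHS](rmorphD (@conjc R)) [X in X + _](rmorphM (@conjc R)).
by congr (_ * _ + _); exact/esym/dotC.
Qed.

HB.instance Definition _ :=
  bilinear_isBilinear.Build _ _ _ _ _ _ dotspace_dot dot_bilinear.

Let dot_hermitian x y :
  dotspace_dot x y = (-1) ^+ false * conjC (dotspace_dot y x).
Proof. by rewrite expr0 mul1r; exact: dotC. Qed.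

HB.instance Definition _ :=
  isHermitianSesquilinear.Build _ _ _ _ dotspace_dot dot_hermitian.

Let dot_gt0 (x : E) : x != 0 -> 0 < dotspace_dot x x.
Proof.
move=> x0; have /eqP : q x ('i *: (x : U)) = - q x ('i *: (x : U)).
  by rewrite -qil; exact: rdfunC.
by rewrite -addr_eq0 -mulr2n mulrn_eq0 ltcE/= => ->; exact: rdfun_gt0.
Qed.

HB.instance Definition _ := isDotProduct.Build _ _ dotspace_dot dot_gt0.

Let f : {dot E for (@conjC R[i])} := dotspace_dot.

Let norm (x : E) : R[i] := sqrtC (f x x).

Let ler_normD x y : norm (x + y) <= norm x + norm y.
Proof. exact: (dot_triangle f). Qed.

Let normrZ (l : R[i]) x : norm (l *: x) = `|l| * norm x.
Proof.
by rewrite /norm (dnormZ f) rootCMl ?exprn_ge0// sqrCK.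
Qed.

Let normr0_eq0 x : norm x = 0 -> x = 0.
Proof. by move/eqP; rewrite /norm (sqrt_dnorm_eq0 f) => /eqP. Qed.

HB.instance Definition _ := Lmodule_isNormed.Build R[i] E
  ler_normD normrZ normr0_eq0.

Let dot_norm (x : E) : f x x = `|x| ^+ 2.
Proof. by rewrite [`|x|]/Num.norm/= /norm sqrtCK. Qed.

HB.instance Definition _ := NormedModule_hasDot.Build R E dot_norm.

Lemma dotspace_rdot (x y : E) : rdot x y = q x y.
Proof. by []. Qed.

Lemma dotspace_nrmE (x : E) : nrm x ^+ 2 = q x x.
Proof. by rewrite -rdotxx. Qed.


Let seq_complete (F : set_system E) : ProperFilter F -> cauchy F -> cvg F.
Proof.
move=> FF /cauchyP Fc.
have e0 k : 0 < (k.+1%:R^-1)%:C :> R[i] by rewrite ltcR invr_gt0.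
have /choice[u Fu] k : exists x, F (ball x (k.+1%:R^-1)%:C) by exact: Fc.
have uB k x : ball (u k) (k.+1%:R^-1)%:C x -> nrm (u k - x) <= k.+1%:R^-1.
  by rewrite -ball_normE /ball_/= nrmE ltcR => /ltW.
have uu k l : nrm (u k - u l) <= k.+1%:R^-1 + l.+1%:R^-1.
  have [x [/= xk xl]] := filter_ex (filterI (Fu k) (Fu l)).
  have -> : u k - u l = (u k - x) + (x - u l) by rewrite addrA subrK.
  rewrite (le_trans (nrmD _ _))// lerD//; first exact: uB.
  by rewrite nrm_distC; exact: uB.
have [e e_gt0|l ul] := @rdfun_complete _ _ q (fun n => u n : U).
  (* [q] is a squared norm: with d = min 1 e the norm is at most d, and d <= 1 gives d^2 <= d <=
     e. *)
  have [N NP] : exists N, forall n, (N <= n)%N ->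
      n.+1%:R^-1 <= Num.min 1 e / 4 :> R.
    by apply: natSinv_le; rewrite divr_gt0// lt_min ltr01.
  exists N => m n /NP mN /NP nN; rewrite -dotspace_nrmE.
  have := uu m n; have := nrm_ge0 (u m - u n : E).
  have : 0 < Num.min 1 e by rewrite lt_min ltr01.
  have : Num.min 1 e <= 1 by rewrite ge_min lexx.
  have : Num.min 1 e <= e by rewrite ge_min lexx orbT.
  move: (Num.min 1 e) mN nN => d mN nN; set a := nrm _ => de d1 d0 a0 ae.
  have ad : a <= d by move: mN nN ae; set p := m.+1%:R^-1; set t := n.+1%:R^-1; lra.
  by nra.
apply/cvg_ex; exists (l : E); apply/cvgrPdist_le => e.
rewrite ltcE/= => /andP[/eqP e1 e2].
have [N NP] := @natSinv_le R (complex.Re e / 2) ltac:(lra).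
have [M MP] := ul ((complex.Re e / 2) ^+ 2) ltac:(nra).
pose n := maxn N M.
have n1 : n.+1%:R^-1 <= complex.Re e / 2 by rewrite NP// leq_maxl.
have n2 : nrm ((l : E) - u n) <= complex.Re e / 2.
  rewrite -(@ler_pXn2r _ 2)// ?nnegrE ?nrm_ge0 ?dotspace_nrmE ?divr_ge0 ?(ltW e2)//.
  by apply: MP; rewrite leq_maxr.
apply: filterS (Fu n) => x /uB ux.
have -> : e = (complex.Re e)%:C by apply/eqP; rewrite eq_complex/= e1 !eqxx.
rewrite nrm_le; have -> : (l : E) - x = ((l : E) - u n) + (u n - x).
  by rewrite addrA subrK.
rewrite (le_trans (nrmD _ _))// (le_trans (lerD n2 (le_trans ux n1)))//; lra.
Qed.

HB.instance Definition _ := Uniform_isComplete.Build E seq_complete.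

End dotspace.

Lemma hilbert_seq_complete (R : realType) (H : hilbertType R) (u : nat -> H) :
  (forall e : R, 0 < e -> exists N, forall m n, (N <= m)%N -> (N <= n)%N ->
     nrm (u m - u n) <= e) ->
  exists l, forall e : R, 0 < e -> exists N, forall n, (N <= n)%N ->
    nrm (l - u n) <= e.
Proof.
move=> uc; have /cvg_ex[l ul] : cvg (u @ \oo).
  apply/cauchy_cvgP/cauchyP => e; rewrite ltcE/= => /andP[/eqP e1 e2].
  have [N NP] := uc (complex.Re e / 2) ltac:(lra).
  exists (u N); exists N => //= n Nn; rewrite -ball_normE /ball_/= nrmE.
  have -> : e = (complex.Re e)%:C by apply/eqP; rewrite eq_complex/= e1 !eqxx.
  by rewrite ltcR (le_lt_trans (NP _ _ (leqnn _) Nn))//; lra.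
exists l => e e0; have /cvgrPdist_le/(_ e%:C) := ul.
rewrite ltcR => /(_ e0)[N _ NP]; exists N => n /NP/=.
by rewrite nrm_le.
Qed.

(** * Square-summable two-sided sequences *)

Section psum.
Variables (V : nmodType).
Implicit Types a b : int -> V.

(** The window is [-N, N), since [Negz i] is -i-1; hence the boundary indices N and -N under a
    shift. *)
Definition psum N a : V := \sum_(i < N) (a (Posz i) + a (Negz i)).

Lemma psum0 a : psum 0 a = 0.
Proof. by rewrite /psum big_ord0. Qed.

Lemma psumS N a : psum N.+1 a = psum N a + (a (Posz N) + a (Negz N)).
Proof. by rewrite /psum big_ord_recr. Qed.

Lemma eq_psum N a b : a =1 b -> psum N a = psum N b.
Proof. by move=> ab; apply: eq_bigr => i _; rewrite !ab. Qed.

Lemma psumD N a b : psum N (fun i => a i + b i) = psum N a + psum N b.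
Proof. by rewrite /psum -big_split; apply: eq_bigr => i _; rewrite addrACA. Qed.

Lemma psum_shift N a : psum N (fun i => a (i + 1)) + a (- N%:Z) =
  psum N a + a N%:Z.
Proof.
elim: N => [|N IHN]; first by rewrite !psum0 oppr0.
have e1 : Posz N + 1 = N.+1 by rewrite -addn1 PoszD.
have e2 : Negz N + 1 = - N%:Z by rewrite NegzE -e1 opprD addrNK.
rewrite !psumS e1 e2 -NegzE [X in X + _]addrCA IHN -[LHS]addrA [LHS]addrC.
by rewrite -!addrA.
Qed.

Lemma psum_window N a :
  psum N a = \sum_(0 <= k < N.*2) a (k%:Z - N%:Z).
Proof.
elim: N => [|N IHN]; first by rewrite psum0 big_geq.
rewrite psumS IHN doubleS big_nat_recr//= big_nat_recl//= addrA addrAC.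
congr (_ + _); last by congr a; lia.
rewrite addrC sub0r -NegzE; congr (_ + _).
by apply: eq_bigr => i _; congr a; lia.
Qed.

End psum.

Lemma eq_cvgn (R : realType) (u v : nat -> R) (l : R) :
  u =1 v -> v @ \oo --> l -> u @ \oo --> l.
Proof. by move=> /funext->. Qed.

Section psum_real.
Variables (R : realType).
Implicit Types a b : int -> R.

Lemma psumZ N r a : psum N (fun i => r * a i) = r * psum N a.
Proof. by rewrite /psum mulr_sumr; apply: eq_bigr => i _; rewrite mulrDr. Qed.

Lemma ler_psum N a b : (forall i, a i <= b i) -> psum N a <= psum N b.
Proof. by move=> ab; apply: ler_sum => i _; rewrite lerD. Qed.

Lemma psum_nd a : (forall i, 0 <= a i) -> nondecreasing_seq (fun N => psum N a).
Proof.
move=> a0; apply/nondecreasing_seqP => N.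
by rewrite psumS lerDl addr_ge0.
Qed.

Lemma psum_ge0 N a : (forall i, 0 <= a i) -> 0 <= psum N a.
Proof. by move=> a0; rewrite sumr_ge0// => i _; rewrite addr_ge0. Qed.

End psum_real.

Section l2Z.
Variables (R : realType) (H : hilbertType R).

Definition sqsum N (f : int -> H) : R := psum N (fun i => nrm (f i) ^+ 2).

Definition sqsummable : {pred int -> H} := fun f =>
  `[< exists M : R, forall N, sqsum N f <= M >].

Record l2Z := L2Z { l2fun :> int -> H; _ : l2fun \in sqsummable }.

HB.instance Definition _ := [isSub for l2fun].
HB.instance Definition _ := [Choice of l2Z by <:].

Let sqsummable_closed : subsemimod_closed sqsummable.
Proof.
apply: GRing.submod_closed_semi; split.
  apply/asboolP; exists 0 => N; rewrite /sqsum/psum big1// => i _.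
  by rewrite nrm0 expr0n addr0.
move=> a f g /asboolP[M fM] /asboolP[L gL]; apply/asboolP.
exists (2 * nrm a ^+ 2 * M + 2 * L) => N.
have a2 : 0 <= 2 * nrm a ^+ 2 by rewrite mulr_ge0// sqr_ge0.
apply: (@le_trans _ _ (2 * nrm a ^+ 2 * sqsum N f + 2 * sqsum N g)); last first.
  by rewrite lerD ?ler_wpM2l.
rewrite /sqsum -!psumZ -psumD; apply: ler_psum => i.
have -> : (a *: f + g) i = a *: f i + g i by [].
have := sqr_ge0 (nrm (a *: f i) - nrm (g i)).
have : nrm (a *: f i + g i) ^+ 2 <= (nrm (a *: f i) + nrm (g i)) ^+ 2.
  by rewrite lerXn2r ?nnegrE ?addr_ge0 ?nrm_ge0// nrmD.
by rewrite nrmZ; nra.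
Qed.

HB.instance Definition _ :=
  GRing.SubChoice_isSubLmodule.Build _ _ sqsummable l2Z sqsummable_closed.

Implicit Types f g h : l2Z.

Lemma l2ZP f g : (forall i, f i = g i) <-> f = g.
Proof. by split=> [fg|->//]; apply/val_inj/funext. Qed.

Lemma l2ZDE f g i : (f + g) i = f i + g i. Proof. by []. Qed.
Lemma l2ZNE f i : (- f) i = - f i. Proof. by []. Qed.
Lemma l2ZZE a f i : (a *: f) i = a *: f i. Proof. by []. Qed.

Lemma l2Z_bounded f : exists M : R, forall N, sqsum N f <= M.
Proof. by have /asboolP := valP f. Qed.

Let dotseq f g N : R := psum N (fun i => rdot (f i) (g i)).

Definition l2r f g : R := limn (dotseq f g).

Let sq_nd f : nondecreasing_seq (fun N => sqsum N f).
Proof. by apply: psum_nd => i; rewrite sqr_ge0. Qed.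

Let sq_cvg f : cvgn (fun N => sqsum N f).
Proof.
have [M fM] := l2Z_bounded f; apply: nondecreasing_is_cvgn; first exact: sq_nd.
by exists M => _ [N _ <-].
Qed.

(** Polarization: the partial sums are a difference of two square sums, each monotone and
    bounded. *)
Lemma l2r_cvg f g : psum N (fun i => rdot (f i) (g i)) @[N --> \oo] --> l2r f g.
Proof.
suff : cvgn (dotseq f g) by [].
have -> : dotseq f g = (fun N => 4^-1 * (sqsum N (f + g) - sqsum N (f - g))).
  apply/funext => N; rewrite /dotseq /sqsum -mulN1r -psumZ -psumD -psumZ.
  by apply: eq_psum => i; rewrite l2ZDE l2ZDE l2ZNE nrm_sqrD nrm_sqrB; field.
by apply: is_cvgMl_tmp; apply: is_cvgB; exact: sq_cvg.
Qed.

Lemma sqsum_cvg f : sqsum N f @[N --> \oo] --> l2r f f.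
Proof.
apply: (eq_cvgn _ (@l2r_cvg f f)) => N.
by apply: eq_psum => i; rewrite rdotxx.
Qed.

Lemma sqsum_le f N : sqsum N f <= l2r f f.
Proof.
rewrite -(cvg_lim _ (@sqsum_cvg f))//.
by apply: (nondecreasing_cvgn_le (sq_nd f)); exact: sq_cvg.
Qed.

Lemma l2r_le f (M : R) : (forall N, sqsum N f <= M) -> l2r f f <= M.
Proof.
move=> fM; rewrite -(cvg_lim _ (@sqsum_cvg f))//.
by apply: limr_le; [exact: sq_cvg|exact: nearW].
Qed.

Lemma l2rE f g (l : R) :
  psum N (fun i => rdot (f i) (g i)) @[N --> \oo] --> l -> l2r f g = l.
Proof. exact: cvg_lim. Qed.

Lemma l2rC f g : l2r f g = l2r g f.
Proof.
by congr (limn _); apply/funext => N; apply: eq_psum => i; rewrite rdotC.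
Qed.

Lemma l2rD f g h : l2r (f + g) h = l2r f h + l2r g h.
Proof.
apply: l2rE; apply: (eq_cvgn _ (cvgD (@l2r_cvg f h) (@l2r_cvg g h))) => N.
by rewrite /= -[RHS]psumD; apply: eq_psum => i; rewrite rdotDl.
Qed.

Lemma l2rZ (a : R) f g : l2r (a%:C *: f) g = a * l2r f g.
Proof.
apply: l2rE. apply: (eq_cvgn _ (cvgMl_tmp (@l2r_cvg f g))) => N.
by rewrite /= -[RHS]psumZ; apply: eq_psum => i; rewrite rdotZl.
Qed.

Lemma l2rZZ (a : R[i]) f g : l2r (a *: f) (a *: g) = nrm a ^+ 2 * l2r f g.
Proof.
apply: l2rE; apply: (eq_cvgn _ (cvgMl_tmp (@l2r_cvg f g))) => N.
by rewrite /= -[RHS]psumZ; apply: eq_psum => i; rewrite rdotZZ.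
Qed.

Lemma l2r_ge0 f : 0 <= l2r f f.
Proof. by rewrite (le_trans _ (sqsum_le f 0))// /sqsum psum0. Qed.

Lemma nrm_l2 f i : nrm (f i) ^+ 2 <= l2r f f.
Proof.
have sq j : 0 <= nrm (f j) ^+ 2 by rewrite sqr_ge0.
case: i => n; rewrite (le_trans _ (sqsum_le f n.+1))// /sqsum psumS.
- by rewrite addrCA lerDl addr_ge0// psum_ge0.
- by rewrite addrA lerDr addr_ge0// psum_ge0.
Qed.

Lemma l2r_eq0 f : l2r f f = 0 -> f = 0.
Proof.
move=> f0; apply/l2ZP => i; apply: nrm_eq0; apply/eqP.
by rewrite -sqrf_eq0 eq_le sqr_ge0 -{1}f0 nrm_l2.
Qed.

(** The limit is taken coordinatewise. On a finite window the bound e passes to the limit in m, with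
    a threshold independent of the window, and so it holds for the whole sum. *)
Lemma l2r_complete (u : nat -> l2Z) :
  (forall e, 0 < e -> exists N, forall m n, (N <= m)%N -> (N <= n)%N ->
     l2r (u m - u n) (u m - u n) <= e) ->
  exists l, forall e, 0 < e -> exists N, forall n, (N <= n)%N ->
    l2r (l - u n) (l - u n) <= e.
Proof.
move=> uc.
have /choice[l ul] i : exists l, forall e : R, 0 < e -> exists N, forall n,
    (N <= n)%N -> nrm (l - u n i) <= e.
  apply: (@hilbert_seq_complete _ _ (fun n => u n i)) => e e0.
  have [|N NP] := uc (e ^+ 2); first by rewrite exprn_gt0.
  exists N => m n Nm Nn; rewrite -(@ler_pXn2r _ 2)// ?nnegrE ?nrm_ge0 ?(ltW e0)//.
  by rewrite (le_trans _ (NP _ _ Nm Nn))//; exact: (nrm_l2 (u m - u n) i).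
have u_cvg n i : (nrm (u m i - u n i) ^+ 2 @[m --> \oo] --> nrm (l i - u n i) ^+ 2).
  rewrite expr2; apply: (eq_cvgn (fun m => expr2 _)).
  suff X : nrm (u m i - u n i) @[m --> \oo] --> nrm (l i - u n i) by exact: cvgM.
  apply/cvgrPdist_le => e /(ul i)[N NP]; exists N => // m /NP /= le_e.
  rewrite (le_trans (nrm_dist _ _))// (le_trans _ le_e)//.
  by rewrite opprB addrA subrK.
have sum_cvg n K : sqsum K (u m - u n) @[m --> \oo] --> sqsum K
  (fun i => l i - u n i).
  elim: K => [|K IHK].
    rewrite /sqsum psum0; apply: (eq_cvgn (fun m => psum0 _)); exact: cvg_cst.
  rewrite /sqsum psumS; apply: (eq_cvgn (fun m => psumS _ _)).
  by apply: cvgD => //; apply: cvgD; exact: u_cvg.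
have sum_le e : 0 < e -> exists N, forall n, (N <= n)%N ->
    forall K, sqsum K (fun i => l i - u n i) <= e.
  move=> /uc[N NP]; exists N => n Nn K; rewrite -(cvg_lim _ (@sum_cvg n K))//.
  apply: limr_le; first by apply/cvg_ex; eexists; exact: sum_cvg.
  by exists N => // m Nm; rewrite (le_trans (sqsum_le _ _)) ?NP.
have lP : l \in sqsummable.
  have [N NP] := sum_le 1 ltr01.
  have dP : (fun i => l i - u N i) \in sqsummable.
    by apply/asboolP; exists 1 => K; exact: NP.
  have -> : l = (L2Z dP + u N : l2Z).
    by apply/funext => i; rewrite l2ZDE/= subrK.
  exact: valP.
exists (L2Z lP) => e /sum_le[N NP]; exists N => n Nn.
by apply: l2r_le => K; exact: NP.
Qed.

End l2Z.

(** * Discrete Fourier transform *)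

Lemma prim_root_exists (C : numClosedFieldType) n :
  (0 < n)%N -> exists z : C, n.-primitive_root z.
Proof.
pose p : {poly C} := 'X^n - 1; have [r Dp] := closed_field_poly_normal p.
move=> n_gt0; rewrite (monicP _) ?monicXnsubC// scale1r in Dp.
have rn1 : all n.-unity_root r.
  by apply/allP => z; rewrite -root_prod_XsubC -Dp.
have sz_r : (n < (size r).+1)%N.
  by rewrite -(size_prod_XsubC r id) -Dp size_XnsubC.
have [|z] := hasP (cyclic.has_prim_root n_gt0 rn1 _ sz_r); last by exists z.
by rewrite -separable.separable_prod_XsubC -Dp cyclotomic.separable_Xn_sub_1//
  pnatr_eq0 -lt0n.
Qed.

Section discrete_fourier.
Variables (R : realType) (H : hilbertType R) (M : nat) (w : R[i]).
Hypothesis wP : M.-primitive_root w.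
Implicit Types a b : nat -> H.

Lemma prim_root_nrm : nrm w = 1.
Proof.
have M0 := prim_order_gt0 wP; apply/eqP.
by rewrite -(@pexpr_eq1 _ _ M)// ?nrm_ge0// -nrmX (prim_expr_order wP) nrm1.
Qed.

Let wJ : w * w^*%C = 1.
Proof. by rewrite mulCJ prim_root_nrm expr1n. Qed.

(** Unnormalized, hence the factor M in Parseval's identity. With exponent + j k, moving a sequence
    one step to the right multiplies its j-th transform by w^j. *)
Definition dft a j : H := \sum_(k < M) w ^+ (j * k) *: a k.

Lemma prim_root_orthogonal (k l : 'I_M) :
  \sum_(j < M) w ^+ (j * k) * (w ^+ (j * l))^*%C = (M * (k == l))%:R.
Proof.
pose x := w ^+ k * w^*%C ^+ l.
rewrite (eq_bigr (fun j : 'I_M => x ^+ j)); last first.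
  by move=> j _; rewrite /x exprMn -!exprM rmorphXn ![(j * _)%N]mulnC.
have [kl|kl] := eqVneq k l.
  have -> : x = 1 by rewrite /x kl -exprMn wJ expr1n.
  rewrite (eq_bigr (fun _ => 1)) => [|j _]; last by rewrite expr1n.
  by rewrite sumr_const card_ord muln1.
rewrite muln0.
have x1 : x != 1.
  apply: contra kl => /eqP x1.
  have : w ^+ k == w ^+ l.
    by rewrite -[eqbRHS]mul1r -x1 /x -mulrA -exprMn [_ * w]mulrC wJ expr1n mulr1.
  by rewrite (eq_prim_root_expr wP) !modn_small.
have : x ^+ M - 1 = 0.
  rewrite /x exprMn -!exprM ![(_ * M)%N]mulnC !exprM -rmorphXn.
  by rewrite (prim_expr_order wP) rmorph1 !expr1n mul1r subrr.
rewrite subrX1 => /eqP; rewrite mulf_eq0 subr_eq0 (negbTE x1)/= => /eqP ->.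
by [].
Qed.

Lemma parseval_dft a b :
  \sum_(j < M) rdot (dft a j) (dft b j) = M%:R * \sum_(k < M) rdot (a k) (b k).
Proof.
rewrite /rdot -!Re_sum mulr_natl -raddfMn/=; congr complex.Re.
transitivity (\sum_(j < M) \sum_(k < M) \sum_(l < M)
    w ^+ (j * k) * (w ^+ (j * l))^*%C * '[a k, b l]).
  apply: eq_bigr => j _; rewrite /dft linear_sumlz; apply: eq_bigr => k _.
  rewrite linear_sumr; apply: eq_bigr => l _.
  by rewrite linearZl_LR linearZr_LR/= mulrA.
rewrite exchange_big/= -sumrMnl; apply: eq_bigr => k _.
rewrite exchange_big/= (bigD1 k)//= [X in _ + X]big1 ?addr0.
  by rewrite -mulr_suml prim_root_orthogonal eqxx muln1 mulr_natl.
move=> l lk; rewrite -mulr_suml prim_root_orthogonal eq_sym (negbTE lk).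
by rewrite muln0 mul0r.
Qed.

End discrete_fourier.

Section window.
Variables (R : realType) (H : hilbertType R) (rho c : R) (A : 'B(H)).
Hypothesis Apos : forall z x, nrm z = 1 -> c * nrm x ^+ 2 <= rform rho x (z *: A x).

(* On the cyclic group of order [n.+1], where the shift does not wrap around
   sequences supported in [0, n), the Fourier transform turns
   [A (x) shift] into the operators [w ^+ j *: A]. *)
Lemma rform_window (g : nat -> H) n :
  c * (\sum_(k < n) nrm (g k) ^+ 2) <=
    rho * (\sum_(k < n) nrm (g k) ^+ 2)
    - 2 * (rho - 1) *
      (\sum_(k < n) rdot (if k : nat is k'.+1 then A (g k') else 0) (g k))
    + (rho - 2) * (\sum_(k < n) nrm (A (g k)) ^+ 2).
Proof.
pose h k := if k is k'.+1 then A (g k') else 0.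
have [w wP] := @prim_root_exists R[i] n.+1 isT.
pose g' k := if (k < n)%N then g k else 0.
pose h' k := if k is k'.+1 then A (g' k') else 0.
have g'n : g' n = 0 by rewrite /g' ltnn.
have g'E (k : 'I_n) : g' k = g k by rewrite /g' ltn_ord.
have sum_gg : \sum_(k < n.+1) rdot (g' k) (g' k) = \sum_(k < n) nrm (g k) ^+ 2.
  rewrite big_ord_recr/= g'n rdotxx nrm0 expr0n addr0.
  by apply: eq_bigr => k _; rewrite rdotxx g'E.
have sum_hh : \sum_(k < n.+1) rdot (h' k) (h' k) = \sum_(k < n) nrm (A (g k)) ^+ 2.
  rewrite big_ord_recl/= rdotxx nrm0 expr0n add0r.
  by apply: eq_bigr => k _; rewrite /= /bump/= rdotxx g'E.
have sum_hg : \sum_(k < n.+1) rdot (h' k) (g' k) = \sum_(k < n) rdot (h k) (g k).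
  rewrite big_ord_recr/= g'n rdot0r addr0.
  apply: eq_bigr => -[[|k] kn] _ /=; rewrite /g' kn//.
  by rewrite (ltnW kn).
have dft_h j : dft n.+1 w h' j = w ^+ j *: A (dft n.+1 w g' j).
  rewrite /dft big_ord_recl/= scaler0 add0r big_ord_recr/= g'n scaler0 addr0.
  rewrite linear_sum scaler_sumr; apply: eq_bigr => k _.
  by rewrite /= linearZ/= scalerA -exprD /bump/= add1n mulnS.
rewrite -sum_gg -sum_hh -sum_hg -(@ler_pM2l _ n.+1%:R)// [leRHS]mulrDr mulrBr.
rewrite ![n.+1%:R * (_ * _)]mulrCA.
rewrite -!(parseval_dft wP) !mulr_sumr -sumrB -big_split/=; apply: ler_sum => j _.
rewrite dft_h !rdotxx. apply: Apos.
by rewrite nrmX (prim_root_nrm wP) expr1n.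
Qed.

End window.

(** * Orthogonal projection onto the range of an isometry *)

Section projection.
Variables (R : realType) (H E : hilbertType R) (J : {linear H -> E}).

Hypothesis Jiso : forall x y, '[J x, J y] = '[x, y].

(** Along a minimizing sequence, z - J (u k) becomes orthogonal to J(H) at a uniform rate ([small]).
    Tested against u m - u n, this makes u Cauchy in H. *)
Lemma projection_exists z : exists p, forall x, '[z - J p, J x] = 0.
Proof.
have nJ y : nrm (J y) = nrm y := nrm_isometry y Jiso.
pose S := [set nrm (z - J x) ^+ 2 | x in [set: H]].
have S_inf : has_inf S.
  split; first by exists (nrm (z - J 0) ^+ 2), 0.
  by exists 0 => _ [x _ <-]; rewrite sqr_ge0.
have /choice[u uP] (k : nat) : exists x, nrm (z - J x) ^+ 2 <= inf S + k.+1%:R^-1.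
  have [|_ [x _ <-] xk] := @inf_adherent _ S k.+1%:R^-1 _ S_inf.
    by rewrite invr_gt0.
  by exists x; rewrite ltW.
have small e : 0 < e -> exists N, forall k, (N <= k)%N -> forall x,
    rdot (z - J (u k)) (J x) <= e * nrm x.
  move=> e0; have [|N NP] := @natSinv_le R (e ^+ 2); first by rewrite exprn_gt0.
  exists N => k /NP ke x; have [x0|x0] := eqVneq (nrm x) 0.
    by rewrite (nrm_eq0 x0) linear0 rdot0r nrm0 mulr0.
  have {}x0 : 0 < nrm x by rewrite lt_def x0 nrm_ge0.
  (* The step e / |x| gives the displacement norm e, to match 1/(k+1) <= e^2. *)
  have : inf S <= nrm (z - J (u k + (e / nrm x)%:C *: x)) ^+ 2.
    by apply: ge_inf; [case: S_inf|exists (u k + (e / nrm x)%:C *: x)].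
  rewrite linearD linearZ/= opprD addrA nrm_sqrB rdotZr nrmZ nJ.
  rewrite nrmC ?divr_ge0 ?nrm_ge0 ?(ltW e0)// divfK ?gt_eqF// => inf_le.
  have : (e / nrm x) * rdot (z - J (u k)) (J x) <= e * e.
    by have := uP k; move: ke inf_le; rewrite expr2; set t := k.+1%:R^-1; lra.
  by rewrite mulrAC -mulrA ler_pM2l// ler_pdivrMr.
have [|p pP] := @hilbert_seq_complete _ _ u.
  move=> e e0; have [|N NP] := small (e / 2); first by rewrite divr_gt0.
  exists N => m n Nm Nn; set d := u m - u n.
  have [->|d0] := eqVneq (nrm d) 0; first exact: ltW.
  have {}d0 : 0 < nrm d by rewrite lt_def d0 nrm_ge0.
  rewrite -(ler_pM2r d0) -expr2 -rdotxx.
  have -> : rdot d d = rdot (z - J (u n)) (J d) + rdot (z - J (u m)) (J (- d)).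
    rewrite linearN rdotNr -rdotNl -rdotDl opprB addrC subrKA -linearB.
    by rewrite /rdot Jiso.
  by have := NP _ Nn d; have := NP _ Nm (- d); rewrite nrmN; lra.
exists p => x.
have ortho y : rdot (z - J p) (J y) <= 0.
  apply/ler_addgt0Pr => e e0; rewrite add0r.
  have y0 := nrm_ge0 y; pose t := e / (2 * (nrm y + 1)).
  have t0 : 0 < t by rewrite divr_gt0// mulr_gt0//; lra.
  have [N NP] := small _ t0; have [N' NP'] := pP _ t0.
  pose k := maxn N N'; have := NP _ (leq_maxl _ _ : (N <= k)%N) y.
  have := NP' _ (leq_maxr _ _ : (N' <= k)%N).
  have -> : rdot (z - J p) (J y) = rdot (z - J (u k)) (J y) - rdot (p - u k) y.
    have <- : rdot (J (p - u k)) (J y) = rdot (p - u k) y by rewrite /rdot Jiso.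
    by rewrite -rdotNl -rdotDl linearB opprB addrA subrK.
  have /ler_normlP[+ _] := rdot_le (p - u k) y.
  have te : t * (2 * (nrm y + 1)) = e by rewrite divfK// gt_eqF// mulr_gt0//; lra.
  by move: (nrm (p - u k)) (nrm_ge0 (p - u k)) => a a0; nra.
have ortho0 y : rdot (z - J p) (J y) = 0.
  have := ortho (- y); rewrite linearN rdotNr oppr_le0 => y0.
  by apply/eqP; rewrite eq_le ortho y0.
have -> : 0 = '[0 : H, 0] by rewrite linear0l.
by apply: hdot_eq; rewrite ?rdot0l -?linearZ ortho0.
Qed.

End projection.

(** * Shifts on square-summable sequences *)

Section l2_operators.
Variables (R : realType) (H : hilbertType R).
Implicit Types f g : l2Z H.

Lemma l2r_sqrD f g : l2r (f + g) (f + g) = l2r f f + 2 * l2r f g + l2r g g.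
Proof. by rewrite l2rD [l2r f _]l2rC [l2r g _]l2rC !l2rD [l2r g f]l2rC; ring. Qed.

Lemma l2r_iso (F : l2Z H -> l2Z H) : {morph F : f g / f + g} ->
  (forall f, l2r (F f) (F f) = l2r f f) -> forall f g, l2r (F f) (F g) = l2r f g.
Proof.
move=> FD Fn f g; have := Fn (f + g); rewrite FD !l2r_sqrD !Fn; lra.
Qed.

Let shl_le f N : sqsum N (fun i => f (i + 1)) <= l2r f f.
Proof.
apply: le_trans (sqsum_le f N.+1).
have := psum_shift N (fun i => nrm (f i) ^+ 2); rewrite -/(sqsum _ _).
rewrite /sqsum psumS /= => e.
have := sqr_ge0 (nrm (f (- N%:Z))); have := sqr_ge0 (nrm (f (Negz N))).
lra.
Qed.

Let shr_le f N : sqsum N (fun i => f (i - 1)) <= l2r f f.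
Proof.
apply: le_trans (sqsum_le f N.+1).
have := psum_shift N (fun i => nrm (f (i - 1)) ^+ 2).
rewrite (eq_psum _ (b := fun i => nrm (f i) ^+ 2)) => [|i]; last by rewrite addrK.
have -> : - N%:Z - 1 = Negz N by rewrite NegzE -addn1 PoszD opprD.
rewrite /sqsum psumS /= => e.
have := sqr_ge0 (nrm (f N)); have := sqr_ge0 (nrm (f (N%:Z - 1))).
lra.
Qed.

Let shlP f : (fun i => f (i + 1)) \in @sqsummable R H.
Proof. by apply/asboolP; exists (l2r f f) => N; exact: shl_le. Qed.

Let shrP f : (fun i => f (i - 1)) \in @sqsummable R H.
Proof. by apply/asboolP; exists (l2r f f) => N; exact: shr_le. Qed.

Definition shl f : l2Z H := L2Z (shlP f).
Definition shr f : l2Z H := L2Z (shrP f).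

Lemma shlE f i : shl f i = f (i + 1). Proof. by []. Qed.
Lemma shrE f i : shr f i = f (i - 1). Proof. by []. Qed.

Lemma shlK : cancel shl shr.
Proof. by move=> f; apply/l2ZP => i; rewrite shrE shlE subrK. Qed.

Lemma shrK : cancel shr shl.
Proof. by move=> f; apply/l2ZP => i; rewrite shlE shrE addrK. Qed.

Lemma shlD : {morph shl : f g / f + g}.
Proof. by move=> f g; apply/l2ZP. Qed.

Lemma l2r_shl f g : l2r (shl f) (shl g) = l2r f g.
Proof.
apply: l2r_iso => [|{}f]; first exact: shlD.
apply/eqP; rewrite eq_le; apply/andP; split.
  by apply: l2r_le => N; exact: shl_le.
by rewrite -{1 2}[f]shlK; apply: l2r_le => N; exact: shr_le.
Qed.

Lemma l2r_shr f g : l2r (shr f) (shr g) = l2r f g.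
Proof. by rewrite -l2r_shl !shrK. Qed.

Variable A : 'B(H).

Let ampl_le f N : sqsum N (fun i => A (f i)) <= opnorm A ^+ 2 * l2r f f.
Proof.
apply: (@le_trans _ _ (opnorm A ^+ 2 * sqsum N f)); last first.
  by rewrite ler_wpM2l ?sqr_ge0// sqsum_le.
rewrite /sqsum -psumZ; apply: ler_psum => i; rewrite -exprMn.
by rewrite lerXn2r ?nnegrE ?mulr_ge0 ?nrm_ge0 ?opnorm_ge0// opnorm_nrm.
Qed.

Let amplP f : (fun i => A (f i)) \in @sqsummable R H.
Proof. by apply/asboolP; eexists => N; exact: ampl_le. Qed.

Definition ampl f : l2Z H := L2Z (amplP f).

Definition opshift f := ampl (shr f).

Lemma opshiftE f i : opshift f i = A (f (i - 1)). Proof. by []. Qed.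

Lemma opshiftD : {morph opshift : f g / f + g}.
Proof. by move=> f g; apply/l2ZP => i; rewrite opshiftE [LHS]linearD. Qed.

Lemma opshiftZ a : {morph opshift : f / a *: f}.
Proof. by move=> f; apply/l2ZP => i; rewrite opshiftE [LHS]linearZ. Qed.

Lemma opshift_shl f : opshift (shl f) = shl (opshift f).
Proof.
by apply/l2ZP => i; rewrite opshiftE !shlE opshiftE subrK addrK.
Qed.

Lemma l2r_opshift_le f : l2r (opshift f) (opshift f) <= opnorm A ^+ 2 * l2r f f.
Proof. by rewrite -[in leRHS]l2r_shr; apply: l2r_le => N; exact: ampl_le. Qed.

Let singleP (x : H) : (fun i : int => if i == 0 then x else 0) \in @sqsummable R H.
Proof.
apply/asboolP; exists (nrm x ^+ 2) => -[|N]; first by rewrite /sqsum psum0 sqr_ge0.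
by rewrite /sqsum /psum big_ord_recl/= big1 => [|i _]; rewrite nrm0 expr0n ?addr0.
Qed.

Definition single x : l2Z H := L2Z (singleP x).

Lemma l2r_single f x : l2r f (single x) = rdot (f 0) x.
Proof.
apply: l2rE; rewrite -cvg_shiftS /=.
apply: (eq_cvgn _ (cvg_cst _)) => N.
by rewrite /psum big_ord_recl/= big1 => [|i _]; rewrite !rdot0r ?addr0.
Qed.

End l2_operators.

(** * The dilation *)

Section dilation.
Variables (R : realType) (H : hilbertType R) (rho c M s : R) (A : 'B(H)).
Hypotheses (rho1 : 1 <= rho) (c0 : 0 < c) (s01 : 0 <= s < 1).
Hypothesis Apos : forall z x, nrm z = 1 -> c * nrm x ^+ 2 <= rform rho x (z *: A x).
Hypothesis Apow : forall n x, nrm ((A ^+ n) x) <= M * s ^+ n * nrm x.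
Implicit Types (f g : l2Z H) (x y : H).

Let B := opshift A.

(** With t = 1/rho, this equals t <f - B f, g> + t <f, g - B g> + (1 - 2 t) <f - B f, g - B g>. On
    orbits f - B f is concentrated at one index, so these products can be read off; on the diagonal,
    rho times the form is [rform] summed with y = B f. *)
Definition dil_dot f g : R := l2r f g
  - (1 - rho^-1) * (l2r (B f) g + l2r f (B g)) + (1 - 2 * rho^-1) * l2r (B f) (B g).

Let rho0 : 0 < rho. Proof. exact: lt_le_trans rho1. Qed.
Let t0 : 0 < rho^-1. Proof. by rewrite invr_gt0. Qed.
Let t1 : rho^-1 <= 1. Proof. by rewrite invf_le1. Qed.
Let rhot : rho * rho^-1 = 1. Proof. by rewrite divff// gt_eqF. Qed.

Lemma dil_dotC f g : dil_dot f g = dil_dot g f.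
Proof.
by rewrite /dil_dot [l2r f g]l2rC [l2r (B f) g]l2rC [l2r f _]l2rC
  [l2r (B f) _]l2rC; ring.
Qed.

Lemma dil_dotD f g h : dil_dot (f + g) h = dil_dot f h + dil_dot g h.
Proof. by rewrite /dil_dot /B opshiftD !l2rD; ring. Qed.

Lemma dil_dotZ (a : R) f g : dil_dot (a%:C *: f) g = a * dil_dot f g.
Proof. by rewrite /dil_dot /B opshiftZ !l2rZ; ring. Qed.

Lemma dil_dotZZ (a : R[i]) f g :
  dil_dot (a *: f) (a *: g) = nrm a ^+ 2 * dil_dot f g.
Proof. by rewrite /dil_dot /B !opshiftZ !l2rZZ; ring. Qed.

Lemma dil_dot_le f : dil_dot f f <= 2 * (1 + opnorm A ^+ 2) * l2r f f.
Proof.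
have Ble := l2r_opshift_le A f; have := l2r_ge0 (B f + f).
have f0 := l2r_ge0 f; have Bf0 := l2r_ge0 (B f).
rewrite l2r_sqrD /dil_dot [l2r f (B f)]l2rC -/B in Ble * => D0.
have : (1 - rho^-1) * (2 * l2r (B f) f) >=
    - ((1 - rho^-1) * (l2r (B f) (B f) + l2r f f)).
  rewrite -mulrN ler_wpM2l ?subr_ge0//; lra.
have : rho^-1 * (l2r (B f) (B f)) >= 0 by rewrite mulr_ge0// ltW.
have : rho^-1 * l2r f f >= 0 by rewrite mulr_ge0// ltW.
move: (rho^-1) t0 t1 => t tt0 tt1.
move: (l2r f f) (l2r (B f) f) (l2r (B f) (B f)) f0 Bf0 Ble D0 => a b d.
by lra.
Qed.

(** [rform_window] is applied on [-N-1, N+1), then N goes to infinity. The finite shift brings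
    nothing in from outside the window, so the product <B f, f> at -N-1 is missing; [v N], built
    from increments of convergent sums, dominates it and tends to 0. *)
Lemma dil_dot_ge f : c * l2r f f <= rho * dil_dot f f.
Proof.
pose v N := 2 * (rho - 1) *
  ((sqsum N.+1 f - sqsum N f) + (sqsum N.+1 (B f) - sqsum N (B f))).
pose w N := rho * sqsum N f - 2 * (rho - 1) * psum N (fun i => rdot (B f i) (f i))
  + (rho - 2) * sqsum N (ampl A f).
have lB : l2r (ampl A f) (ampl A f) = l2r (B f) (B f).
  by rewrite -l2r_shr; congr l2r; apply/l2ZP.
have wE : rho * dil_dot f f = rho * l2r f f - 2 * (rho - 1) * l2r (B f) f
   + (rho - 2) * l2r (B f) (B f).
  rewrite /dil_dot [l2r f (B f)]l2rC mulrDr mulrBr !mulrA.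
  rewrite [rho * (1 - _)]mulrBr [rho * (1 - 2 * _)]mulrBr mulrCA rhot; ring.
have v_cvg : v N @[N --> \oo] --> 0.
  rewrite -(mulr0 (2 * (rho - 1))); apply: cvgMl_tmp.
  rewrite -[X in _ --> X](addr0 0) -{1}(subrr (l2r f f)) -(subrr (l2r (B f) (B f))).
  by apply: cvgD; apply: cvgB; rewrite ?(cvg_shiftS (fun N => sqsum N _));
    exact: sqsum_cvg.
have w_cvg : w N @[N --> \oo] --> rho * dil_dot f f.
  rewrite wE -lB; apply: cvgD; last by apply: cvgMl_tmp; exact: sqsum_cvg.
  apply: cvgB; apply: cvgMl_tmp; first exact: sqsum_cvg.
  exact: l2r_cvg.
have cvg1 : w N.+1 + v N - c * sqsum N.+1 f @[N --> \oo] -->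
    rho * dil_dot f f + 0 - c * l2r f f.
  apply: cvgB; first by apply: cvgD => //; rewrite (cvg_shiftS w).
  by apply: cvgMl_tmp; rewrite (cvg_shiftS (fun N => sqsum N f)); exact: sqsum_cvg.
rewrite -subr_ge0 -[rho * _]addr0 -(cvg_lim _ cvg1)//.
apply: limr_ge; first by apply/cvg_ex; eexists; exact: cvg1.
apply: nearW => N; rewrite subr_ge0.
pose g (k : nat) := f (k%:Z - N.+1%:Z).
have := rform_window Apos g N.+1.*2.
have sumE (a : int -> R) : psum N.+1 a = \sum_(k < N.+1.*2) a (k%:Z - N.+1%:Z).
  by rewrite psum_window big_mkord.
have -> : \sum_(k < N.+1.*2) nrm (g k) ^+ 2 = sqsum N.+1 f by rewrite /sqsum sumE.
have -> : \sum_(k < N.+1.*2) nrm (A (g k)) ^+ 2 = sqsum N.+1 (ampl A f).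
  by rewrite /sqsum sumE.
move=> /le_trans; apply; rewrite /w [leRHS]addrAC lerD2r -addrA lerD2l.
have -> : psum N.+1 (fun i => rdot (B f i) (f i)) =
  (\sum_(k < N.+1.*2) rdot (if k : nat is k'.+1 then A (g k') else 0) (g k)) +
  rdot (B f (- N.+1%:Z)) (f (- N.+1%:Z)).
  rewrite sumE doubleS big_ord_recl [in RHS]big_ord_recl rdot0l.
  rewrite [X in _ = X + _]add0r addrC.
  congr (_ + _); first by congr (rdot (B f _) (f _)); rewrite /=; lia.
  apply: eq_bigr => i _; rewrite /g /B opshiftE; congr (rdot (A (f _)) _).
  by rewrite lift0 -[i.+1]addn1 PoszD addrAC addrK.
have : 0 <= 2 * (rho - 1) by rewrite mulr_ge0// subr_ge0.
rewrite /v; move: (2 * (rho - 1)) => k k0.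
rewrite mulrDr opprD -addrA lerDl addrC subr_ge0 ler_wpM2l//.
have /ler_normlP[_ /le_trans] := rdot_le (B f (- N.+1%:Z)) (f (- N.+1%:Z)); apply.
rewrite /sqsum !psumS -NegzE.
have := sqr_ge0 (nrm (f N)); have := sqr_ge0 (nrm (B f N)).
have := sqr_ge0 (nrm (f (Negz N))); have := sqr_ge0 (nrm (B f (Negz N))).
have := sqr_ge0 (nrm (f (Negz N)) - nrm (B f (Negz N))).
by rewrite sqrrB; lra.
Qed.

Let dil_ge f : c / rho * l2r f f <= dil_dot f f.
Proof. by rewrite mulrAC ler_pdivrMr// [leRHS]mulrC dil_dot_ge. Qed.

Let cr0 : 0 < c / rho. Proof. exact: divr_gt0. Qed.

Let dil_gt0 f : f != 0 -> 0 < dil_dot f f.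
Proof.
move=> f0; apply: lt_le_trans (dil_ge f); rewrite mulr_gt0// lt_def l2r_ge0 andbT.
by apply: contra f0 => /eqP/l2r_eq0->.
Qed.

Let dil_i f g : dil_dot ('i *: f) ('i *: g) = dil_dot f g.
Proof.
rewrite dil_dotZZ /nrm normc_def/= expr0n add0r expr1n sqrtr1 expr1n.
by rewrite mul1r.
Qed.

Let C0 : 0 < 2 * (1 + opnorm A ^+ 2).
Proof. by rewrite mulr_gt0// ltr_pwDl// sqr_ge0. Qed.

Let dil_complete (u : nat -> l2Z H) :
  (forall e, 0 < e -> exists N, forall m n, (N <= m)%N -> (N <= n)%N ->
     dil_dot (u m - u n) (u m - u n) <= e) ->
  exists l, forall e, 0 < e -> exists N, forall n, (N <= n)%N ->
    dil_dot (l - u n) (l - u n) <= e.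
Proof.
move=> uc; have [e e0|l ul] := @l2r_complete _ _ u.
  have [|N NP] := uc (c / rho * e); first exact: mulr_gt0.
  exists N => m n Nm Nn; rewrite -(ler_pM2l cr0).
  by rewrite (le_trans (dil_ge _))// NP.
exists l => e e0; have [|N NP] := ul (e / (2 * (1 + opnorm A ^+ 2))).
  exact: divr_gt0.
exists N => n /NP; rewrite ler_pdivlMr// mulrC; apply: le_trans.
exact: dil_dot_le.
Qed.

Definition dil_real_dot : real_dot (l2Z H) :=
  RealDot dil_dotC dil_dotD dil_dotZ dil_i dil_gt0 dil_complete.

Local Notation E := (dotspace dil_real_dot).

Lemma dil_dot_shl f g : dil_dot (shl f) (shl g) = dil_dot f g.
Proof. by rewrite /dil_dot /B !opshift_shl !l2r_shl. Qed.

Let shlE_nrm (f : E) : nrm (shl f : E) = nrm f.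
Proof.
apply/eqP; rewrite -(@eqrXn2 _ 2)// ?nrm_ge0//.
by rewrite !dotspace_nrmE; apply/eqP; exact: dil_dot_shl.
Qed.

Let shrE_nrm (f : E) : nrm (shr f : E) = nrm f.
Proof. by rewrite -shlE_nrm; congr (@nrm _ E _); exact: shrK. Qed.

Let shl_bounded : (@shl R H : E -> E) \in @bounded_linear R E.
Proof.
apply/asboolP; split; first by move=> a f g; apply/l2ZP.
by exists 1 => f; rewrite mul1r shlE_nrm.
Qed.

Let shr_bounded : (@shr R H : E -> E) \in @bounded_linear R E.
Proof.
apply/asboolP; split; first by move=> a f g; apply/l2ZP.
by exists 1 => f; rewrite mul1r shrE_nrm.
Qed.

Let U : 'B(E) := Bop shl_bounded.
Let V : 'B(E) := Bop shr_bounded.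

Let UV : U * V = 1.
Proof. by apply/bopP => f; exact: shrK. Qed.

Let VU : V * U = 1.
Proof. by apply/bopP => f; exact: shlK. Qed.

Let U_unitary : unitary U.
Proof.
exists V => // f g; rewrite -[g in LHS](shrK g); apply: hdot_eq.
  exact: dil_dot_shl.
rewrite (_ : 'i%C *: _ = shl ('i%C *: shr g)); last by apply/l2ZP.
exact: dil_dot_shl.
Qed.

Let orbitP x : (fun i : int => if i is Posz n then (A ^+ n) x else 0)
  \in @sqsummable R H.
Proof.
have /andP[s0 s1] := s01; have s2 : s ^+ 2 < 1 by rewrite exprn_ilt1.
apply/asboolP; exists ((M * nrm x) ^+ 2 / (1 - s ^+ 2)) => N.
apply: (@le_trans _ _ ((M * nrm x) ^+ 2 * \sum_(i < N) (s ^+ 2) ^+ i)).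
  rewrite mulr_sumr; apply: ler_sum => i _; rewrite nrm0 expr0n addr0.
  rewrite -exprM mulnC exprM -exprMn mulrAC.
  by rewrite lerXn2r ?nnegrE ?nrm_ge0// (le_trans _ (Apow i x))// nrm_ge0.
rewrite ler_wpM2l ?sqr_ge0// -div1r ler_pdivlMr ?subr_gt0//.
rewrite -opprB mulrN mulrC -subrX1 opprB gerBl exprn_ge0// sqr_ge0//.
Qed.

Let J (x : H) : E := L2Z (orbitP x).

Let J_linear : linear J.
Proof.
move=> a x y; apply/l2ZP => -[n|n]; first exact: (linearP (A ^+ n)).
by rewrite l2ZDE l2ZZE/= scaler0 addr0.
Qed.

HB.instance Definition _ := GRing.isLinear.Build _ _ _ _ J J_linear.

(** The orbit obeys the recursion of B except at its first term, where B sees the value 0 at index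
    -1. *)
Let BJ x : B (J x) = J x - single x.
Proof.
apply/l2ZP => i; rewrite l2ZDE l2ZNE /B opshiftE/=; case: i => [[|n]|n] /=.
- by rewrite linear0 subrr.
- by rewrite subr0 exprS bopME; congr (A _); rewrite subn1.
- by rewrite subr0 linear0.
Qed.

Let UnE n f i : ((U ^+ n) f : l2Z H) i = f (i + n%:Z).
Proof.
elim: n f => [|n IHn] f; first by rewrite expr0 bop1E addr0.
by rewrite exprSr bopME IHn /U/=; congr (f _); lia.
Qed.

Let dil_dotJ f x : dil_dot f (J x) = rho^-1 * l2r (f - B f) (J x)
  + (1 - rho^-1) * rdot (f 0) x - (1 - 2 * rho^-1) * rdot (B f 0) x.
Proof.
have Nl g h : l2r (- g) h = - l2r g h.
  by rewrite -scaleN1r -[-1](rmorphN1 (real_complex R)) l2rZ mulN1r.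
rewrite /dil_dot BJ ![l2r _ (J x - _)]l2rC !l2rD !Nl !(l2rC (single x)) !l2r_single.
by rewrite ![l2r (J x) _]l2rC; ring.
Qed.

(** The vector (1 - B) U^n J x sits at index -n < 0, off the support of J y. What remains are the
    values of U^n J x and B U^n J x at 0, both A^n x, with weights 1 - 1/rho and -(1 - 2/rho), of
    sum 1/rho. *)
Let dil_dotUJ n x y : (0 < n)%N ->
  dil_dot ((U ^+ n) (J x)) (J y) = rho^-1 * rdot ((A ^+ n) x) y.
Proof.
case: n => // n _; rewrite dil_dotJ; set f : l2Z H := (U ^+ n.+1) (J x).
have fB i : (f - B f) i = single x (i + n.+1%:Z).
  have -> : single x = J x - B (J x) by rewrite BJ subKr.
  rewrite l2ZDE l2ZNE [RHS]l2ZDE l2ZNE /B !opshiftE /f !UnE.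
  by congr (_ - A (J x _)); rewrite addrAC.
have -> : l2r (f - B f) (J y) = 0.
  apply: l2rE; apply: (eq_cvgn _ (cvg_cst _)) => N.
  rewrite /psum big1// => i _; rewrite !fB /= rdot0r addr0 ifN ?rdot0l//.
  by lia.
rewrite /B opshiftE /f !UnE sub0r add0r.
have -> : -1 + n.+1%:Z = n by lia.
rewrite /= -bopME -exprS; ring.
Qed.

Let dil_dotJJ x y : dil_dot (J x) (J y) = rdot x y.
Proof.
rewrite dil_dotJ BJ subKr l2rC l2r_single l2ZDE l2ZNE/= subrr rdot0l.
by rewrite [rdot y x]rdotC; ring.
Qed.

Lemma rform_class_C : class_C rho A.
Proof.
have Jiso x y : '[J x, J y] = '[x, y].
  by apply: hdot_eq; rewrite -?linearZ; exact: dil_dotJJ.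
have /choice[P PP] := projection_exists (J := J) Jiso.
exists E, J, P, U; split => // n n0 x; apply/eqP; rewrite -subr_eq0.
apply/eqP/nrm_eq0/eqP; rewrite -sqrf_eq0 -rdotxx; set d := _ - _.
have Pd : '[P ((U ^+ n) (J x)), d] = '[(U ^+ n) (J x), J d].
  have /eqP := PP ((U ^+ n) (J x)) d; rewrite linearBl/= Jiso subr_eq0.
  by move=> /eqP.
rewrite {1}/d rdotDl rdotNl rdotZl {2}/rdot Pd -/(rdot _ _) dotspace_rdot.
by rewrite /= dil_dotUJ// mulrA rhot mul1r subrr.
Qed.

End dilation.

(** * The relation between K and its radius *)

Section radius_rel.
Variables (R : realType) (rho : R).
Hypothesis rho1 : 1 <= rho.
Implicit Types K k : R.

Definition radius_rel K k := K + K^-1 = rho * k + (2 - rho) / k.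

Lemma radius_relP K k : 0 < K -> 0 < k ->
  radius_rel K k <-> (K ^+ 2 + 1) * k = K * (rho * k ^+ 2 + 2 - rho).
Proof.
move=> K0 k0; have K0' := lt0r_neq0 K0; have k0' := lt0r_neq0 k0.
have -> : (K ^+ 2 + 1) * k = (K + K^-1) * (K * k) by field.
have -> : K * (rho * k ^+ 2 + 2 - rho) = (rho * k + (2 - rho) / k) * (K * k).
  by field.
split=> [->//|]; apply: mulIf; exact: mulf_neq0.
Qed.

Let lt_add_inv (a : R) (b x y : R) : a <= b -> 0 < b -> 1 <= x -> x < y ->
  b * x + a / x < b * y + a / y.
Proof.
move=> ab b0 x1 xy; have x0 : 0 < x by exact: lt_le_trans x1.
have y0 : 0 < y by exact: lt_trans xy.
rewrite -subr_gt0 (_ : _ - _ = (y - x) * (b - a / (x * y))).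
  rewrite mulr_gt0 ?subr_gt0// ltr_pdivrMr ?mulr_gt0//.
  by rewrite (le_lt_trans ab)// ltr_pMr//; nra.
by field; rewrite !lt0r_neq0.
Qed.

(** Both sides of the relation have the form b x + a / x with a <= b and b > 0 (2 - rho <= rho on
    the right), which is strictly increasing for x >= 1. *)
Lemma radius_rel_lt K k K' k' : 1 <= K -> 1 <= k -> 1 <= K' -> 1 <= k' ->
  radius_rel K k -> radius_rel K' k' -> (K < K') = (k < k').
Proof.
have addK (x : R) : x + x^-1 = 1 * x + 1 / x by rewrite mul1r div1r.
have rho0 : 0 < rho by exact: lt_le_trans rho1.
have rho2 : 2 - rho <= rho by have := rho1; lra.
move=> K1 k1 K'1 k'1; rewrite /radius_rel !addK => Kk K'k'.
apply/idP/idP => [KK'|kk'].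
- rewrite ltNge; apply/negP => k'k.
  have := lt_add_inv (lexx 1) ltr01 K1 KK'; rewrite Kk K'k'.
  move: k'k; rewrite le_eqVlt => /orP[/eqP->|k'k]; first by rewrite ltxx.
  by move=> /lt_trans/(_ (lt_add_inv rho2 rho0 k'1 k'k)); rewrite ltxx.
- rewrite ltNge; apply/negP => K'K.
  have := lt_add_inv rho2 rho0 k1 kk'; rewrite -Kk -K'k'.
  move: K'K; rewrite le_eqVlt => /orP[/eqP->|K'K]; first by rewrite ltxx.
  by move=> /lt_trans/(_ (lt_add_inv (lexx 1) ltr01 K'1 K'K)); rewrite ltxx.
Qed.

Lemma radius_rel11 : radius_rel 1 1.
Proof. by rewrite /radius_rel invr1; ring. Qed.

Lemma radius_rel_radius K : 1 <= K ->
  let k := (K ^+ 2 + 1 +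
     Num.sqrt ((K ^+ 2 + 1) ^+ 2 - 4 * rho * (2 - rho) * K ^+ 2)) / (2 * rho * K) in
  1 <= k /\ radius_rel K k.
Proof.
move=> K1 k; have K0 : 0 < K by exact: lt_le_trans K1.
have rho0 : 0 < rho by exact: lt_le_trans rho1.
set D := _ - _ in k *; have rK : 0 < 2 * rho * K by rewrite !mulr_gt0.
(* This identity gives D >= 0 and also k >= 1, where k is the larger root of the quadratic in
   [radius_relP]. *)
have D_ge : (2 * rho * K - (K ^+ 2 + 1)) ^+ 2 <= D.
  rewrite -subr_ge0 (_ : _ - _ = 4 * rho * K * (K - 1) ^+ 2);
    last by rewrite /D; ring.
  by rewrite mulr_ge0 ?sqr_ge0// !mulr_ge0// ltW.
have D0 : 0 <= D by apply: le_trans D_ge; exact: sqr_ge0.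
have k1 : 1 <= k.
  rewrite ler_pdivlMr// mul1r -lerBlDl (le_trans (ler_norm _))//.
  by rewrite -sqrtr_sqr ler_sqrt.
split => //; apply/radius_relP => //; first exact: lt_le_trans k1.
have kE : k * (2 * rho * K) = K ^+ 2 + 1 + Num.sqrt D by rewrite divfK// gt_eqF.
have sD := sqr_sqrtr D0.
have e : (2 * rho * K * k - (K ^+ 2 + 1)) ^+ 2 = D.
  by rewrite -sD [_ * k]mulrC kE; ring.
have c0 : 4 * rho * K != 0 by rewrite !mulf_neq0// lt0r_neq0.
apply: (mulfI c0); apply/eqP; rewrite -subr_eq0; apply/eqP.
by move/eqP: e; rewrite -subr_eq0 /D => /eqP e; rewrite -oppr0 -[in RHS]e; ring.
Qed.

Lemma radius_rel_exists k : 1 <= k -> exists2 K, 1 <= K & radius_rel K k.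
Proof.
move=> k1; have k0 : 0 < k by exact: lt_le_trans k1.
pose m := rho * k + (2 - rho) / k.
have m2 : 2 <= m.
  rewrite -subr_ge0 (_ : m - 2 = (k - 1) * (rho - (2 - rho) / k)).
    rewrite mulr_ge0 ?subr_ge0// ler_pdivrMr//; have := rho1; nra.
  by rewrite /m; field; rewrite gt_eqF.
have D0 : 0 <= m ^+ 2 - 4 by nra.
have s0 := sqrtr_ge0 (m ^+ 2 - 4); have sE := sqr_sqrtr D0.
have K0 : m + Num.sqrt (m ^+ 2 - 4) != 0 by rewrite gt_eqF//; lra.
exists ((m + Num.sqrt (m ^+ 2 - 4)) / 2); first by lra.
rewrite /radius_rel -/m; move: (Num.sqrt _) s0 sE K0 => t t0 tE K0.
have -> : ((m + t) / 2)^-1 = (m - t) / 2.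
  apply: (mulfI (mulf_neq0 K0 (invr_neq0 (lt0r_neq0 (ltr0n R 2))))).
  rewrite divff; last by rewrite mulf_neq0// invr_neq0// pnatr_eq0.
  by transitivity ((m ^+ 2 - t ^+ 2) / 4); [rewrite tE; field|field].
by field.
Qed.

(** Matching the coefficients of |x|^2, |y|^2 and Re <y, x> in [moebius_form] gives three equations
    for c and r, made compatible by the relation. K > 1 yields r < 1. *)
Lemma moebius_coefs K k : 1 < K -> 1 <= k -> radius_rel K k ->
  exists c r, [/\ 0 < c, 0 <= r < 1, c * (K ^+ 2 - r ^+ 2) = rho * k ^+ 2,
    c * (K ^+ 2 * r ^+ 2 - 1) = rho - 2 &
    c * (K ^+ 2 - 1) * r = (rho - 1) * k].
Proof.
move=> K1 k1; have K0 : 0 < K by exact: lt_trans K1.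
have k0 : 0 < k by exact: lt_le_trans k1.
move=> /radius_relP => /(_ K0 k0) rel.
(* The difference of the first two equations and the relation give c (1 - r^2) = k / K; then the
   first gives c (K^2 - 1) = D, and the third gives r. *)
pose D := k * K + rho - 2; have D0 : 0 < D by rewrite /D; have := rho1; nra.
have K21 : 0 < K ^+ 2 - 1 by nra.
pose r := (rho - 1) * k / D; pose c := D / (K ^+ 2 - 1).
have rD : r * D = (rho - 1) * k by rewrite divfK// gt_eqF.
have cK : c * (K ^+ 2 - 1) = D by rewrite divfK// gt_eqF.
have r0 : 0 <= r by rewrite divr_ge0 ?(ltW D0)// mulr_ge0 ?(ltW k0)// subr_ge0.
have r2 : K * r ^+ 2 * D = K * (rho - 2) + k.
  apply: (mulIf (lt0r_neq0 D0)).
  transitivity (K * (r * D) ^+ 2); first by ring.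
  rewrite rD /D.
  have -> : (K * (rho - 2) + k) * (k * K + rho - 2) = K * (rho - 2) ^+ 2
      + (rho - 2) * ((K ^+ 2 + 1) * k) + K * k ^+ 2 by ring.
  by rewrite rel; ring.
exists c, r; split.
- exact: divr_gt0.
- rewrite r0 -(@ltr_pXn2r _ 2)// ?nnegrE// expr1n -(ltr_pM2l (mulr_gt0 K0 D0)).
  rewrite mulr1 mulrAC r2 /D; nra.
- apply: (mulIf (lt0r_neq0 (mulr_gt0 K0 K21))).
  transitivity ((c * (K ^+ 2 - 1)) * K ^+ 3 - K * r ^+ 2 * (c * (K ^+ 2 - 1))).
    by ring.
  rewrite cK r2 /D.
  transitivity ((K ^+ 2 - 1) * ((K ^+ 2 + 1) * k + K * (rho - 2))); first by ring.
  by rewrite rel; ring.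
- apply: (mulIf (lt0r_neq0 (mulr_gt0 K0 K21))).
  transitivity (K ^+ 2 * (K * r ^+ 2 * (c * (K ^+ 2 - 1))) - K * (c * (K ^+ 2 - 1))).
    by ring.
  by rewrite cK r2 /D; ring.
- by rewrite cK mulrC.
Qed.

End radius_rel.

(** * Families of operators stable under disc automorphisms *)

Section moebius.
Variables (R : realType) (H : preHilbertType R).
Implicit Types (x y : H).

Lemma moebius_form (rho K k c r : R) x y :
  c * (K ^+ 2 - r ^+ 2) = rho * k ^+ 2 ->
  c * (K ^+ 2 * r ^+ 2 - 1) = rho - 2 ->
  c * (K ^+ 2 - 1) * r = (rho - 1) * k ->
  rho * k ^+ 2 * nrm x ^+ 2 - 2 * ((rho - 1) * k) * rdot y x
    + (rho - 2) * nrm y ^+ 2 =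
  c * (K ^+ 2 * nrm (x - r%:C *: y) ^+ 2 - nrm (y - r%:C *: x) ^+ 2).
Proof.
move=> <- <- <-; rewrite !nrm_sqrB !rdotZr -![nrm (r%:C *: _) ^+ 2]rdotxx.
by rewrite !rdotZZ !rdotxx [rdot x y]rdotC -nrmX -rmorphXn nrmC ?sqr_ge0//; ring.
Qed.

Lemma scale1Bsqr (r : R) x :
  (1 - r ^+ 2)%:C *: x = x - r%:C *: (r%:C *: x).
Proof. by rewrite rmorphB rmorph1 scalerBl scale1r expr2 rmorphM scalerA. Qed.

(** (1 - r^2) x = (x - r y) + r (y - r x). This turns a margin in |x - r y| into one in |x|, as the
    dilation requires. *)
Lemma moebius_le (K r : R) x y : 0 <= r < 1 -> 0 <= K ->
  nrm (y - r%:C *: x) <= K * nrm (x - r%:C *: y) ->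
  (1 - r ^+ 2) * nrm x <= (1 + r * K) * nrm (x - r%:C *: y).
Proof.
move=> /andP[r0 r1] K0 xy; have r21 : 0 <= 1 - r ^+ 2 by nra.
have -> : (1 - r ^+ 2) * nrm x = nrm ((x - r%:C *: y) + r%:C *: (y - r%:C *: x)).
  by rewrite scalerBr subrKA -scale1Bsqr nrmZ nrmC.
rewrite (le_trans (nrmD _ _))// mulrDl mul1r lerD2l nrmZ nrmC// -mulrA.
exact: ler_wpM2l.
Qed.

End moebius.

Section bop_pow.
Variables (R : realType) (H : hilbertType R).
Implicit Types T : 'B(H).

Lemma bopZX a T n x : ((a *: T) ^+ n) x = a ^+ n *: (T ^+ n) x.
Proof.
elim: n x => [|n IHn] x; first by rewrite !expr0 bop1E scale1r.
by rewrite !exprSr !bopME IHn bopZE linearZ/= scalerA.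
Qed.

Lemma bop_sumE I (r : seq I) (P : pred I) (S : I -> 'B(H)) x :
  (\sum_(i <- r | P i) S i) x = \sum_(i <- r | P i) S i x.
Proof. exact: (big_morph (fun T : 'B(H) => T x)). Qed.

End bop_pow.

Section families.
Variables (R : realType) (rho : R) (H : hilbertType R) (F : set 'B(H)).
Hypothesis rho1 : 1 <= rho.
Hypothesis FZ : forall z T, nrm z = 1 -> F T -> F (z *: T).
Hypothesis FX : forall n T, F T -> F (T ^+ n).
(* [S] is the value at [T] of the polynomial
   [(w - r) (1 + r w + ... + (r w) ^+ n) / (1 + r ^+ n.+1)], which approximates
   the disc automorphism [(w - r) / (1 - r w)]. *)
Hypothesis Fmoebius : forall r n T, 0 <= r < 1 -> F T -> exists2 S, F S &
  forall y, (1 + r ^+ n.+1)%:C *: S (y - r%:C *: T y) =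
    (T y - r%:C *: y) - (r ^+ n.+1)%:C *: (T ^+ n.+1) (T y - r%:C *: y).

(** At x - r T x the polynomial S acts as the automorphism up to r^(n+1), and the bound K on S and
    on T^(n+1) controls the error uniformly in n. *)
Lemma family_moebius K r T x : 0 <= K -> 0 <= r < 1 ->
  (forall T x, F T -> nrm (T x) <= K * nrm x) -> F T ->
  nrm (T x - r%:C *: x) <= K * nrm (x - r%:C *: T x).
Proof.
move=> K0 r01 FK FT; have /andP[r0 r1] := r01.
set u := x - _; set v := _ - _.
rewrite -subr_ge0; apply: (@ge0_geometric _ _ (K * nrm u + K * nrm v) r) => // n.
have q0 : 0 <= r ^+ n.+1 by rewrite exprn_ge0.
have [S FS /(_ x)] := Fmoebius n r01 FT; rewrite -/u -/v.
set q := r ^+ n.+1 in q0 *; move=> Sx.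
have : nrm v - q * (K * nrm v) <= (1 + q) * (K * nrm u).
  apply: (@le_trans _ _ (nrm ((1 + q)%:C *: S u))).
    rewrite Sx (le_trans _ (nrmB_ge _ _))// lerB// nrmZ nrmC//.
    by rewrite ler_wpM2l// FK//; exact: FX.
  by rewrite nrmZ nrmC ?addr_ge0// ler_wpM2l ?addr_ge0// FK.
lra.
Qed.

(** The excess K' > K is spent twice: (K'^2 - K^2) |u|^2 makes the form coercive, and the resulting
    l > 1 makes the powers of T / l decay. These are the two hypotheses on the operator in
    [rform_class_C]. *)
Lemma family_class_C K K' l T :
  1 <= K -> K < K' -> 1 <= l -> radius_rel rho K' l ->
  (forall T x, F T -> nrm (T x) <= K * nrm x) -> F T ->
  class_C rho (l^-1%:C *: T).
Proof.
move=> K1 KK' l1 rel FK FT; have K'1 : 1 < K' by exact: le_lt_trans KK'.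
have l0 : 0 < l by exact: lt_le_trans l1.
have lt1l : 1 < l.
  by rewrite -(radius_rel_lt rho1 (lexx 1) (lexx 1) _ l1 (radius_rel11 rho)
    rel)// ltW.
have [c [r [c0 r01 e1 e2 e3]]] := moebius_coefs rho1 K'1 l1 rel.
have /andP[r0 r1] := r01; have K0 : 0 <= K by exact: le_trans K1.
have r21 : 0 < 1 - r ^+ 2 by nra.
have rK : 0 < 1 + r * K by rewrite ltr_pwDl// mulr_ge0.
(* (1 - r^2) / (1 + r K) is the lower bound of |u| / |x| in [moebius_le]; l^2 undoes the scaling of
   T. *)
pose d := c * ((K' ^+ 2 - K ^+ 2) * ((1 - r ^+ 2) / (1 + r * K)) ^+ 2) / l ^+ 2.
have KK2 : 0 < K' ^+ 2 - K ^+ 2 by nra.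
have d0 : 0 < d by rewrite divr_gt0 ?exprn_gt0// mulr_gt0// mulr_gt0//
  exprn_gt0// divr_gt0.
apply: (@rform_class_C _ _ _ d K l^-1) => //.
- by rewrite invr_ge0 (ltW l0)/= invf_lt1.
- move=> z x z1; have FzT := FZ z1 FT; pose u := x - r%:C *: (z *: T) x.
  rewrite -(ler_pM2r (exprn_gt0 2 l0)) mulrAC divfK ?expf_neq0 ?lt0r_neq0//.
  have -> : rform rho x (z *: (l^-1%:C *: T) x) * l ^+ 2 =
    rho * l ^+ 2 * nrm x ^+ 2 - 2 * ((rho - 1) * l) * rdot ((z *: T) x) x
     + (rho - 2) * nrm ((z *: T) x) ^+ 2.
    rewrite /rform !bopZE scalerA [z * _]mulrC -scalerA rdotZl nrmZ nrmC
      ?invr_ge0 ?(ltW l0)//.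
    by field; rewrite lt0r_neq0.
  rewrite (moebius_form _ _ e1 e2 e3) -/u -mulrA ler_pM2l//.
  have vu := family_moebius x K0 r01 FK FzT; have := moebius_le r01 K0 vu.
  rewrite -/u in vu * => xu.
  rewrite lerBrDr (le_trans (lerD (lexx _) (lerXn2r 2 _ _ vu)))// ?nnegrE
    ?mulr_ge0 ?nrm_ge0//.
  rewrite [(K * _) ^+ 2]exprMn -lerBrDr -mulrBl -mulrA ler_pM2l// -exprMn.
  rewrite lerXn2r// ?nnegrE ?(mulr_ge0 (divr_ge0 (ltW r21) (ltW rK))) ?nrm_ge0//.
  by rewrite mulrAC ler_pdivrMr// [leRHS]mulrC.
- move=> n x; rewrite bopZX nrmZ nrmX nrmC ?invr_ge0 ?(ltW l0)// mulrAC mulrC.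
  rewrite ler_wpM2r ?exprn_ge0 ?invr_ge0 ?(ltW l0)//.
  by apply: FK; exact: FX.
Qed.

(** The inequality |S y + r y| <= K |y + r S y| is used for S close to (T - r) (1 - r T)^-1 and y =
    (1 - r T) x: its sides tend to (1 - r^2) |T x| and K (1 - r^2) |x|. *)
Lemma family_nrm K k T x :
  1 < K -> 1 <= k -> radius_rel rho K k ->
  (forall T, F T -> exists2 l, 0 < l < k & class_C rho (l^-1%:C *: T)) -> F T ->
  nrm (T x) <= K * nrm x.
Proof.
move=> K1 k1 rel FC FT; have K0 : 0 < K by exact: lt_trans K1.
have k0 : 0 < k by exact: lt_le_trans k1.
have [c [r [c0 r01 e1 e2 e3]]] := moebius_coefs rho1 K1 k1 rel.
have /andP[r0 r1] := r01; have r21 : 0 < 1 - r ^+ 2 by nra.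
have FS S y : F S -> nrm (S y + r%:C *: y) <= K * nrm (y + r%:C *: S y).
  move=> /FC[l /andP[l0 lk] CS].
  (* For z = -l/k, l < k gives |z| < 1, and z (S / l) = -S / k; the sign changes the parameter r
     into -r, that of the inverse automorphism. *)
  have := @class_C_rform _ _ rho _ (- (l / k)%:C) y rho1 CS.
  rewrite nrmN nrmC ?divr_ge0 ?(ltW l0) ?(ltW k0)// ltr_pdivrMr// mul1r => /(_ lk).
  have -> : - (l / k)%:C *: (l^-1%:C *: S) y = (k^-1)%:C *: (- S y).
    rewrite bopZE scalerA mulNr -rmorphM scalerN -scaleNr mulrAC divff ?mul1r//.
    exact: lt0r_neq0.
  rewrite -(pmulr_lge0 _ (exprn_gt0 2 k0)) mulrC.
  have -> : k ^+ 2 * rform rho y (k^-1%:C *: - S y) =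
    rho * k ^+ 2 * nrm y ^+ 2 - 2 * ((rho - 1) * k) * rdot (- S y) y
     + (rho - 2) * nrm (- S y) ^+ 2.
    rewrite /rform rdotZl nrmZ nrmC ?invr_ge0 ?(ltW k0)//.
    by field; rewrite lt0r_neq0.
  rewrite (moebius_form _ _ e1 e2 e3) pmulr_rge0// subr_ge0 -exprMn.
  rewrite scalerN opprK -opprD nrmN ler_pXn2r// ?nnegrE ?mulr_ge0 ?nrm_ge0//.
  exact: ltW.
pose v := T x - r%:C *: x; pose u := x - r%:C *: T x.
have TX n y : nrm ((T ^+ n) y) <= k * rho * nrm y.
  have [l /andP[l0 lk] CT] := FC _ (FX n FT).
  have := @class_C_nrmX _ _ rho _ 1 y rho1 CT.
  rewrite expr1 bopZE nrmZ nrmC ?invr_ge0 ?(ltW l0)// mulrC ler_pdivrMr// =>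
    /le_trans.
  apply; rewrite -mulrA [leRHS]mulrC ler_wpM2l ?(ltW lk)// mulr_ge0 ?nrm_ge0//.
  exact: le_trans rho1.
have ruv : v + r%:C *: u = (1 - r ^+ 2)%:C *: T x.
  by rewrite /v /u scalerBr subrKA -scale1Bsqr.
have urv : u + r%:C *: v = (1 - r ^+ 2)%:C *: x.
  by rewrite /v /u scalerBr subrKA -scale1Bsqr.
rewrite -(ler_pM2l r21) -subr_ge0.
apply: (@ge0_geometric _ _ (r * nrm u + k * rho * nrm v
  + K * (nrm u + r * (k * rho * nrm v))) r) => // n.
have q0 : 0 <= r ^+ n.+1 by rewrite exprn_ge0.
have [S Sin /(_ x)] := Fmoebius n r01 FT; rewrite -/u -/v.
set q := r ^+ n.+1 in q0 *; have := TX n.+1 v.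
move: ((T ^+ n.+1) v) => w wv Su; clearbody u v.
have q1 : 0 <= 1 + q by rewrite addr_ge0.
have := ler_wpM2l q1 (FS S u Sin).
rewrite mulrCA -(nrmC q1) -!nrmZ !scalerDr [_ *: (r%:C *: S u)]scalerA.
rewrite [_ * r%:C]mulrC -scalerA Su => main.
have m1 : (1 - r ^+ 2) * nrm (T x) - q * (r * nrm u + k * rho * nrm v) <=
    nrm (v - q%:C *: w + (1 + q)%:C *: (r%:C *: u)).
  have -> : v - q%:C *: w + (1 + q)%:C *: (r%:C *: u) =
     (1 - r ^+ 2)%:C *: T x - q%:C *: (w - r%:C *: u).
    rewrite -ruv rmorphD rmorph1 scalerDl scale1r scalerBr opprB.
    by rewrite addrACA [- _ + _]addrC.
  rewrite (le_trans _ (nrmB_ge _ _))// !nrmZ (nrmC (ltW r21)) (nrmC q0).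
  rewrite lerB// ler_wpM2l// (le_trans (nrmB _ _))// nrmZ nrmC// addrC lerD2l//.
have m2 : nrm ((1 + q)%:C *: u + r%:C *: (v - q%:C *: w)) <=
    (1 - r ^+ 2) * nrm x + q * (nrm u + r * (k * rho * nrm v)).
  have -> : (1 + q)%:C *: u + r%:C *: (v - q%:C *: w) =
     (1 - r ^+ 2)%:C *: x + q%:C *: (u - r%:C *: w).
    rewrite -urv rmorphD rmorph1 scalerDl scale1r !scalerBr.
    by rewrite addrACA !scalerA [r%:C * _]mulrC.
  rewrite (le_trans (nrmD _ _))// !nrmZ (nrmC (ltW r21)) (nrmC q0) lerD2l.
  rewrite ler_wpM2l// (le_trans (nrmB _ _))// nrmZ nrmC// lerD2l ler_wpM2l//.
have := le_trans m1 (le_trans main (ler_wpM2l (ltW K0) m2)).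
lra.
Qed.

(** Each direction needs a strict inequality, so it is proved for k + e or K + e and the related
    partner. K + e > 1 also covers K = 1, where [moebius_coefs] does not apply. *)
Lemma family_equiv K k : 1 <= K -> 1 <= k -> radius_rel rho K k ->
  (forall T, F T -> ((nrm T)%:E <= K%:E)%E) <->
  (forall T, F T -> (op_radius rho T <= k%:E)%E).
Proof.
move=> K1 k1 rel; split=> [FK T FT|Fk T FT].
  have FK' S x : F S -> nrm (S x) <= K * nrm x.
    move=> /FK; rewrite lee_fin => SK; rewrite (le_trans (opnorm_nrm _ _))//.
    by rewrite ler_wpM2r ?nrm_ge0.
  apply/lee_addgt0Pr => e e0; rewrite -EFinD.
  have ke1 : 1 <= k + e by rewrite (le_trans k1)// lerDl ltW.
  have [K' K'1 rel'] := radius_rel_exists rho1 ke1.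
  apply: ereal_inf_lbound; exists (k + e) => //; split.
    exact: lt_le_trans ke1.
  apply: (family_class_C K1 _ ke1 rel' FK' FT).
  by rewrite (radius_rel_lt rho1 K1 k1 K'1 ke1 rel rel') ltrDl.
rewrite lee_fin; apply/ler_addgt0Pr => e e0.
have K'1 : 1 <= K + e by rewrite (le_trans K1)// lerDl ltW.
have [k'1 rel'] := radius_rel_radius rho1 K'1;
  set k' := (X in radius_rel _ _ X) in rel'.
apply: opnorm_le => [|x]; first exact: le_trans K'1.
apply: (@family_nrm (K + e) k' T x _ k'1 rel') => //.
  by rewrite (le_lt_trans K1)// ltrDl.
move=> S /Fk; have kk' : k < k'.
  by rewrite -(radius_rel_lt rho1 K1 k1 K'1 k'1 rel rel') ltrDl.
move=> /le_lt_trans; rewrite -lte_fin in kk'; move=> /(_ _ kk').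
by move=> /ereal_inf_lt[_ [l [l0 Cl] <-]]; rewrite lte_fin => lk; exists l;
  rewrite ?l0.
Qed.

End families.

(** * From equivalent upper bounds to equivalent equalities *)

Section sup_equiv.
Variables (R : realType) (rho : R).
Hypothesis rho1 : 1 <= rho.

(** If W = w were below k, the K' related to w would bound N by a number below K; symmetrically for
    N. Partners are supplied only from 1 on, whence the alternative: below 1 both equalities
    fail. *)
Lemma radius_rel_sup (N W : \bar R) K k :
  (forall K k, 1 <= K -> 1 <= k -> radius_rel rho K k ->
     (N <= K%:E)%E <-> (W <= k%:E)%E) ->
  ((1 <= N)%E /\ (1 <= W)%E) \/ ((N < 1)%E /\ (W < 1)%E) ->
  1 <= K -> 1 <= k -> radius_rel rho K k -> (N = K%:E <-> W = k%:E).
Proof.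
move=> NW [[N1 W1]|[N1 W1]] K1 k1 rel; last first.
  split=> e; first by move: N1; rewrite e lte_fin ltNge K1.
  by move: W1; rewrite e lte_fin ltNge k1.
split=> e.
- have Wk : (W <= k%:E)%E by apply/(NW _ _ K1 k1 rel); rewrite e.
  case: W W1 Wk NW => [w||]//; rewrite !lee_fin => w1 wk NW.
  have [K' K'1 rel'] := radius_rel_exists rho1 w1.
  have := (NW _ _ K'1 w1 rel').2 (lexx _); rewrite e lee_fin => KK'.
  congr EFin; apply/eqP; rewrite eq_le wk leNgt/=.
  by rewrite -(radius_rel_lt rho1 K'1 w1 K1 k1 rel' rel) -leNgt.
- have NK : (N <= K%:E)%E by apply/(NW _ _ K1 k1 rel); rewrite e.
  case: N N1 NK NW => [x||]//; rewrite !lee_fin => x1 xK NW.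
  have [k'1 rel'] := radius_rel_radius rho1 x1.
  set k' := (X in radius_rel _ _ X) in rel'.
  have := (NW _ _ x1 k'1 rel').1 (lexx _); rewrite e lee_fin => kk'.
  congr EFin; apply/eqP; rewrite eq_le xK leNgt/=.
  by rewrite (radius_rel_lt rho1 x1 k'1 K1 k1 rel' rel) -leNgt.
Qed.

End sup_equiv.

Section op_radius.
Variables (R : realType) (rho : R) (H : hilbertType R).
Hypothesis rho1 : 1 <= rho.

(** The zero space is its own dilation space for any scaling; 1/2 merely stands for a bound below
    1. *)
Lemma op_radius_trivial (T : 'B(H)) : (forall x : H, x = 0) ->
  (op_radius rho T <= (2^-1)%:E)%E.
Proof.
move=> H0; apply: ereal_inf_lbound; exists 2^-1 => //; split.
  by rewrite invr_gt0.
exists H, (idfun : {linear H -> H}), idfun, 1; split => //.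
- by move=> z x /=; rewrite subrr linear0l.
- by exists 1; [move=> x y|rewrite mulr1].
- by move=> n _ x; rewrite [LHS]H0 [RHS]H0.
Qed.

(** A scaling l < 1 would give unbounded powers l^-n, against the bound rho of [class_C_nrmX]. *)
Lemma op_radius1_ge (x : H) : x != 0 -> (1 <= op_radius rho (1%R : 'B(H)))%E.
Proof.
move=> x0; apply: le_ereal_inf_tmp => _ [l [l0 Cl] <-]; rewrite lee_fin leNgt.
apply/negP => l1; have nx0 : 0 < nrm x.
  by rewrite lt_def nrm_ge0 andbT; apply: contra x0 => /eqP/nrm_eq0->.
suff : 0 <= (-1 : R) by lra.
apply: (@ge0_geometric _ _ rho l) => [|n]; first by rewrite (ltW l0).
have := class_C_nrmX n.+1 x rho1 Cl.
rewrite bopZX expr1n bop1E nrmZ nrmX nrmC ?invr_ge0 ?(ltW l0)// ler_pM2r//.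
by rewrite exprVn -div1r ler_pdivrMr ?exprn_gt0// addrC subr_ge0.
Qed.

Lemma nrm_bop1_ge (x : H) : x != 0 -> 1 <= nrm (1 : 'B(H)).
Proof.
move=> x0; have nx0 : 0 < nrm x.
  by rewrite lt_def nrm_ge0 andbT; apply: contra x0 => /eqP/nrm_eq0->.
by rewrite -(ler_pM2r nx0) mul1r; exact: (opnorm_nrm (1 : 'B(H)) x).
Qed.

Lemma nrm_bop_trivial (T : 'B(H)) : (forall x : H, x = 0) -> nrm T <= 0.
Proof. by move=> H0; apply: opnorm_le => // x; rewrite [T x]H0 nrm0 mul0r. Qed.

End op_radius.

(** * Truncated disc automorphisms of an operator *)

Section moebius_op.
Variables (R : realType) (H : hilbertType R).
Implicit Types (T : 'B(H)) (x y : H) (r : R).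

Definition moebius_op r n T : 'B(H) :=
  \sum_(i < n.+1) (r ^+ i)%:C *: (T ^+ i * (T - r%:C *: (1 : 'B(H)))).

(** Polynomials in T commute, so the factor 1 - r T in the argument telescopes the geometric sum. *)
Lemma moebius_opE r n T y :
  moebius_op r n T (y - r%:C *: T y) =
    (T y - r%:C *: y) - (r ^+ n.+1)%:C *: (T ^+ n.+1) (T y - r%:C *: y).
Proof.
set v := T y - r%:C *: y.
have e : (T - r%:C *: (1 : 'B(H))) (y - r%:C *: T y) = v - r%:C *: T v.
  have -> : (T - r%:C *: (1 : 'B(H))) (y - r%:C *: T y) =
    T (y - r%:C *: T y) - r%:C *: (y - r%:C *: T y) by [].
  rewrite /v !(linearB T) !(linearZ_LR T)/= !scalerBr !opprB.
  rewrite [LHS]addrACA [RHS]addrACA.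
  by congr (_ + _); exact: addrC.
clearbody v; rewrite /moebius_op; elim: n => [|n IHn].
  by rewrite big_ord1 !expr0 rmorph1 scale1r mul1r e !expr1.
rewrite big_ord_recr bopDE IHn bopZE bopME e (linearB (T ^+ n.+1)).
rewrite (linearZ_LR (T ^+ n.+1)) scalerBr.
by rewrite subrKA scalerA -rmorphM -exprSr [T ^+ n.+2]exprSr.
Qed.

Lemma contraction_moebius r T x : 0 <= r < 1 -> nrm (T x) <= nrm x ->
  nrm (T x - r%:C *: x) <= nrm (x - r%:C *: T x).
Proof.
move=> /andP[r0 r1] Tx; rewrite -(@ler_pXn2r _ 2)// ?nnegrE ?nrm_ge0//.
rewrite !nrm_sqrB !rdotZr !nrmZ nrmC// [rdot x _]rdotC.
have := nrm_ge0 (T x); move: (nrm (T x)) (nrm x) Tx => a b ab a0.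
have : a ^+ 2 <= b ^+ 2 by nra.
have : 0 <= 1 - r ^+ 2 by nra.
move=> h1 h2; have := mulr_ge0 h1 (_ : 0 <= b ^+ 2 - a ^+ 2);
  rewrite subr_ge0 h2 => /(_ isT).
by rewrite !exprMn; lra.
Qed.

(* The von Neumann inequality for the polynomial of [moebius_op]. *)
Lemma contraction_moebius_op r n T : 0 <= r < 1 -> opnorm T <= 1 ->
  opnorm (moebius_op r n T) <= 1 + r ^+ n.+1.
Proof.
move=> r01 T1; have /andP[r0 r1] := r01; set q := r ^+ n.+1.
have q0 : 0 <= q by rewrite exprn_ge0.
have Tx x : nrm (T x) <= nrm x.
  by rewrite (le_trans (opnorm_nrm _ _))// ler_piMl// nrm_ge0.
have TX m x : nrm ((T ^+ m) x) <= nrm x.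
  elim: m x => [|m IHm] x; first by rewrite expr0.
  by rewrite exprSr bopME (le_trans (IHm _)).
apply: opnorm_le => [|x]; first by rewrite addr_ge0.
set Q := moebius_op r n T; rewrite -subr_ge0.
apply: (@ge0_geometric _ _ ((1 + q) * nrm x + opnorm Q * nrm x) r) => // m.
set s := r ^+ m.+1; have s0 : 0 <= s by rewrite exprn_ge0.
(* [moebius_opE] describes Q only on the range of 1 - r T; this truncated Neumann series solves (1 -
   r T) u = x up to an error of order s. *)
pose u := \sum_(j < m.+1) (r ^+ j)%:C *: (T ^+ j) x.
have uE : u - r%:C *: T u = x - s%:C *: (T ^+ m.+1) x.
  rewrite /u /s; elim: m {s s0 u} => [|m IHm].
    by rewrite big_ord1 !expr0 rmorph1 scale1r !expr1.
  rewrite big_ord_recr/= linearD scalerDr opprD addrACA IHm subrKA.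
  by rewrite (linearZ_LR T) scalerA -rmorphM -exprS.
have : nrm (Q (u - r%:C *: T u)) <= (1 + q) * nrm (u - r%:C *: T u).
  rewrite moebius_opE (le_trans (nrmB _ _))// nrmZ nrmC// mulrDl mul1r.
  have vu := contraction_moebius r01 (Tx u).
  by rewrite lerD// ler_wpM2l// (le_trans (TX _ _)).
rewrite uE linearB linearZ/= => /(le_trans (nrmB_ge _ _)).
have xs : nrm (x - s%:C *: (T ^+ m.+1) x) <= nrm x + s * nrm x.
  by rewrite (le_trans (nrmB _ _))// nrmZ nrmC// lerD2l ler_wpM2l.
have Qs : nrm (s%:C *: Q ((T ^+ m.+1) x)) <= s * (opnorm Q * nrm x).
  rewrite nrmZ nrmC// ler_wpM2l// (le_trans (opnorm_nrm _ _))//.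
  by rewrite ler_wpM2l ?opnorm_ge0.
move=> main; have := le_trans main (ler_wpM2l _ xs).
rewrite addr_ge0// => /(_ isT); lra.
Qed.

End moebius_op.

(** * Homomorphisms of Banach and operator algebras *)

Section scalar_moebius.
Variables (R : realType).

Lemma nrm_sqr_complex (z : R[i]) :
  nrm z ^+ 2 = complex.Re z ^+ 2 + complex.Im z ^+ 2.
Proof. by rewrite /nrm normc_def/= sqr_sqrtr// addr_ge0// sqr_ge0. Qed.

Definition moebius_poly (r : R) n : {poly R[i]} :=
  \sum_(i < n.+1) (r ^+ i)%:C%:P * ('X ^+ i * ('X - r%:C%:P)).

(** On the disc the sum is (z - r) / (1 - r z) times 1 - (r z)^(n+1), of moduli at most 1 and 1 +
    r^(n+1). *)
Lemma nrm_moebius_poly (r : R) n (z : R[i]) : 0 <= r < 1 -> nrm z < 1 ->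
  nrm (moebius_poly r n).[z] <= 1 + r ^+ n.+1.
Proof.
move=> /andP[r0 r1] z1; pose w := r%:C * z.
have z0 := nrm_ge0 z.
have w1 : nrm w < 1 by rewrite nrmM nrmC//; nra.
have w1' : 0 < nrm (1 - w).
  rewrite (lt_le_trans _ (nrmB_ge _ _))// nrm1 subr_gt0//.
have e : (moebius_poly r n).[z] * (1 - w) = (z - r%:C) * (1 - w ^+ n.+1).
  rewrite /moebius_poly horner_sum.
  rewrite (eq_bigr (fun i : 'I_n.+1 => w ^+ i * (z - r%:C))) => [|i _].
    by rewrite -mulr_suml -[1 - w]opprB -[1 - w ^+ _]opprB subrX1; ring.
  by rewrite !hornerE /w exprMn rmorphXn.
have zr : nrm (z - r%:C) <= nrm (1 - w).
  rewrite -(@ler_pXn2r _ 2)// ?nnegrE ?nrm_ge0//.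
  have : nrm z ^+ 2 < 1 by rewrite exprn_ilt1.
  rewrite !nrm_sqr_complex /w; case: z {z1 z0 w w1 w1' e} => a b /= ab.
  rewrite -subr_ge0 [leRHS](_ : _ = (1 - r ^+ 2) * (1 - (a ^+ 2 + b ^+ 2))).
    by rewrite mulr_ge0// subr_ge0 ?(ltW ab)// exprn_ile1// ltW.
  by ring.
rewrite -(ler_pM2r w1') -nrmM e nrmM mulrC ler_pM ?nrm_ge0//.
rewrite (le_trans (nrmB _ _))// nrm1 lerD2l nrmX lerXn2r ?nnegrE ?nrm_ge0//.
by rewrite nrmM nrmC// ler_piMr// ltW.
Qed.

End scalar_moebius.

Section hom_families.
Variables (R : realType) (rho : R) (H : hilbertType R).
Hypothesis rho1 : 1 <= rho.

Section banach_algebra.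
Variables (A : banachAlgType R) (Phi : {lrmorphism A -> 'B(H)}).
Hypothesis vN : von_neumann_ineq A.

Let anorm_horner (p : {poly R[i]}) (a : A) (M : R) : anorm a <= 1 ->
  (forall z, nrm z < 1 -> nrm p.[z] <= M) -> anorm (horner_alg a p) <= M.
Proof.
move=> a1 pM; rewrite -lee_fin (le_trans (vN p a1))//.
by apply: ge_ereal_sup => _ [z z1 <-]; rewrite lee_fin pM.
Qed.

Let F : set 'B(H) := [set Phi a | a in [set a : A | anorm a <= 1]].

Let FZ (z : R[i]) T : nrm z = 1 -> F T -> F (z *: T).
Proof.
move=> z1 [a a1 <-]; exists (z *: a); last by rewrite linearZ.
by rewrite /= anormZ z1 mul1r.
Qed.

Let FX n T : F T -> F (T ^+ n).
Proof.
move=> [a a1 <-]; exists (a ^+ n); last by rewrite rmorphXn.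
rewrite /= -(horner_algX a) -rmorphXn; apply: anorm_horner => // z z1.
by rewrite hornerXn nrmX exprn_ile1 ?nrm_ge0// ltW.
Qed.

Let Fmoebius r n T : 0 <= r < 1 -> F T -> exists2 S, F S &
  forall y, (1 + r ^+ n.+1)%:C *: S (y - r%:C *: T y) =
    (T y - r%:C *: y) - (r ^+ n.+1)%:C *: (T ^+ n.+1) (T y - r%:C *: y).
Proof.
move=> r01 [a a1 <-]; have /andP[r0 r1] := r01.
have q0 : 0 < 1 + r ^+ n.+1 by rewrite ltr_pwDl// exprn_ge0.
pose b := horner_alg a (moebius_poly r n).
exists ((1 + r ^+ n.+1)^-1%:C *: Phi b).
  exists ((1 + r ^+ n.+1)^-1%:C *: b); last by rewrite linearZ.
  rewrite /= anormZ nrmC ?invr_ge0 ?(ltW q0)// mulrC ler_pdivrMr// mul1r.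
  by apply: anorm_horner => // z; exact: nrm_moebius_poly.
move=> y; rewrite bopZE scalerA -rmorphM divff ?lt0r_neq0// rmorph1 scale1r.
rewrite -moebius_opE; congr (bop_fun _ _).
have -> : b = \sum_(i < n.+1) (r ^+ i)%:C *: (a ^+ i * (a - r%:C *: 1)).
  rewrite /b rmorph_sum; apply: eq_bigr => i _.
  rewrite !rmorphM rmorphB (rmorphXn (horner_alg a))/= !horner_algC horner_algX.
  by rewrite mulr_algl.
have PS (f : 'I_n.+1 -> A) : Phi (\sum_i f i) = \sum_i Phi (f i).
  by rewrite raddf_sum.
have PZ c x : Phi (c *: x) = c *: Phi x by rewrite linearZ.
have PB x y' : Phi (x - y') = Phi x - Phi y' by rewrite rmorphB.
have PM x y' : Phi (x * y') = Phi x * Phi y' by rewrite rmorphM.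
rewrite PS; apply: eq_bigr => i _.
by rewrite PZ PM (rmorphXn Phi) PB PZ rmorph1.
Qed.

Let F1 : F 1.
Proof.
exists 1; last by rewrite rmorph1.
(* The bound on the norm of 1 is the von Neumann inequality for the constant polynomial 1 at the
   element 0. *)
rewrite /= -(rmorph1 (horner_alg (0 : A))); apply: anorm_horner => [|z _].
  by rewrite -(scale0r (0 : A)) anormZ nrm0 mul0r.
by rewrite hornerE nrm1.
Qed.

Lemma hom_norm_radius K k : 1 <= K -> 1 <= k -> radius_rel rho K k ->
  (hom_norm Phi <= K%:E)%E <-> (hom_radius Phi rho <= k%:E)%E.
Proof.
move=> K1 k1 rel; have [NW WN] := family_equiv rho1 FZ FX Fmoebius K1 k1 rel.
split=> /ereal_supP sup_le; apply/ereal_supP => _ [a a1 <-].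
  apply: NW; last by exists a.
  by move=> _ [b b1 <-]; apply: sup_le; exists b.
apply: WN; last by exists a.
by move=> _ [b b1 <-]; apply: sup_le; exists b.
Qed.

Lemma hom_norm_radius_dichotomy :
  ((1 <= hom_norm Phi)%E /\ (1 <= hom_radius Phi rho)%E) \/
  ((hom_norm Phi < 1)%E /\ (hom_radius Phi rho < 1)%E).
Proof.
have [[x x0]|H0] := pselect (exists x : H, x != 0).
  have [a a1 Pa] := F1; left; split.
    apply: le_trans (ereal_sup_ubound (ex_intro2 _ _ a a1 erefl)).
    by rewrite Pa lee_fin (nrm_bop1_ge x0).
  apply: le_trans (ereal_sup_ubound (ex_intro2 _ _ a a1 erefl)).
  by rewrite Pa (op_radius1_ge rho1 x0).
have {}H0 (x : H) : x = 0.
  by apply: contrapT => /eqP x0; apply: H0; exists x.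
right; split.
  apply: (@le_lt_trans _ _ 0%:E); last by rewrite lte_fin.
  by apply/ereal_supP => _ [a _ <-]; rewrite lee_fin nrm_bop_trivial.
apply: (@le_lt_trans _ _ (2^-1)%:E); last by rewrite lte_fin invf_lt1// ltr1n.
by apply/ereal_supP => _ [a _ <-]; exact: op_radius_trivial.
Qed.

End banach_algebra.

End hom_families.

Section amplification.
Variables (R : realType) (A : algType R[i]) (H : hilbertType R) (n : nat).
Variable Phi : {lrmorphism A -> 'B(H)}.
Implicit Types M N : 'M[A]_n.

(** Stated for any representation, because it serves both [Phi] and the inclusion of A in B(L) that
    defines the norm of M_n(A). *)
Definition amplify M : 'B(l2sum H n) := mxop (map_mx Phi M).

Lemma amplifyE M f i : amplify M f i = \sum_(j < n) Phi (M i j) (f j).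
Proof. by rewrite mxopE; apply: eq_bigr => j _; rewrite mxE. Qed.

Let ampP (S T : 'B(l2sum H n)) : (forall f i, S f i = T f i) -> S = T.
Proof. by move=> ST; apply/bopP => f; apply/ffunP => i. Qed.

Lemma amplify1 : amplify 1 = 1.
Proof.
apply: ampP => f i; rewrite amplifyE (bigD1 i)//= mxE eqxx rmorph1 big1 ?addr0//.
by move=> j ji; rewrite mxE eq_sym (negbTE ji) raddf0.
Qed.

Lemma amplifyD M N : amplify (M + N) = amplify M + amplify N.
Proof.
apply: ampP => f i; rewrite bopDE [RHS]ffunE !amplifyE -big_split/=.
by apply: eq_bigr => j _; rewrite mxE raddfD.
Qed.

(** Matrices over A are a module over A here, so a complex scalar acts through [c%:A]. *)
Lemma amplifyZ (c : R[i]) M : amplify (c%:A *: M) = c *: amplify M.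
Proof.
apply: ampP => f i; rewrite bopZE [RHS]ffunE !amplifyE scaler_sumr.
by apply: eq_bigr => j _; rewrite mxE mulr_algl linearZ.
Qed.

Lemma amplifyM M N : amplify (M * N) = amplify M * amplify N.
Proof.
apply: ampP => f i; rewrite bopME !amplifyE.
transitivity (\sum_(j < n) \sum_(k < n) Phi (M i k) (Phi (N k j) (f j))).
  apply: eq_bigr => j _; rewrite mxE.
  have -> : Phi (\sum_k M i k * N k j) = \sum_k Phi (M i k) * Phi (N k j).
    by rewrite raddf_sum; apply: eq_bigr => k _; exact: (rmorphM Phi).
  by rewrite bop_sumE; apply: eq_bigr => k _; rewrite bopME.
rewrite exchange_big/=; apply: eq_bigr => k _.
by rewrite amplifyE linear_sum.
Qed.

Lemma amplifyX M m : amplify (M ^+ m) = amplify M ^+ m.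
Proof.
by elim: m => [|m IHm]; rewrite ?expr0 ?amplify1// !exprS amplifyM IHm.
Qed.

Definition moebius_mx (r : R) m M : 'M[A]_n :=
  \sum_(i < m.+1) (r ^+ i)%:C%:A *: (M ^+ i * (M + (- r%:C)%:A *: (1 : 'M[A]_n))).

Lemma amplify_moebius r m M :
  amplify (moebius_mx r m M) = moebius_op r m (amplify M).
Proof.
have amplify0 : amplify 0 = 0.
  by apply: ampP => f i; rewrite amplifyE [RHS]ffunE big1// => j _;
    rewrite mxE raddf0.
rewrite /moebius_mx /moebius_op (big_morph amplify amplifyD amplify0).
apply: eq_bigr => i _; rewrite amplifyZ amplifyM amplifyX amplifyD amplifyZ.
by rewrite amplify1 scaleNr.
Qed.

End amplification.

Section opalg_families.
Variables (R : realType) (rho : R) (A : opAlg R) (H : hilbertType R).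
Variable Phi : {lrmorphism A -> 'B(H)}.
Hypothesis rho1 : 1 <= rho.

Section fixed_size.
Variable n : nat.

Let F : set 'B(l2sum H n) :=
  [set ampliation Phi M | M in [set M : 'M[A]_n | opalg_mxnorm M <= 1]].

Let normZ (c : R[i]) (M : 'M[A]_n) :
  opalg_mxnorm (c%:A *: M) = nrm c * opalg_mxnorm M.
Proof. by rewrite /opalg_mxnorm -/(amplify _ _) amplifyZ nrmZ. Qed.

Let FZ (z : R[i]) T : nrm z = 1 -> F T -> F (z *: T).
Proof.
move=> z1 [M M1 <-]; exists (z%:A *: M); last exact: amplifyZ.
by rewrite /= normZ z1 mul1r.
Qed.

Let FX m T : F T -> F (T ^+ m).
Proof.
move=> [M M1 <-]; exists (M ^+ m); last exact: amplifyX.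
rewrite /= /opalg_mxnorm -/(amplify _ _) amplifyX.
apply: opnorm_le => // x; rewrite mul1r; elim: m x => [|m IHm] x.
  by rewrite expr0.
rewrite exprSr bopME (le_trans (IHm _))// (le_trans (opnorm_nrm _ _))//.
by rewrite ler_piMl// nrm_ge0.
Qed.

Let Fmoebius r m T : 0 <= r < 1 -> F T -> exists2 S, F S &
  forall y, (1 + r ^+ m.+1)%:C *: S (y - r%:C *: T y) =
    (T y - r%:C *: y) - (r ^+ m.+1)%:C *: (T ^+ m.+1) (T y - r%:C *: y).
Proof.
move=> r01 [M M1 <-]; have /andP[r0 r1] := r01.
have q0 : 0 < 1 + r ^+ m.+1 by rewrite ltr_pwDl// exprn_ge0.
exists ((1 + r ^+ m.+1)^-1%:C *: amplify Phi (moebius_mx r m M)).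
  exists ((1 + r ^+ m.+1)^-1%:C%:A *: moebius_mx r m M); last exact: amplifyZ.
  rewrite /= normZ nrmC ?invr_ge0 ?(ltW q0)// mulrC ler_pdivrMr// mul1r.
  (* The polynomial is read in B(L^(n)), where M acts as a contraction. *)
  rewrite /opalg_mxnorm -/(amplify _ _) amplify_moebius.
  exact: contraction_moebius_op.
move=> y; rewrite bopZE scalerA -rmorphM divff ?lt0r_neq0// rmorph1 scale1r.
by rewrite amplify_moebius moebius_opE.
Qed.

Lemma ampliation_norm_radius K k : 1 <= K -> 1 <= k -> radius_rel rho K k ->
  (forall T, F T -> ((nrm T)%:E <= K%:E)%E) <->
  (forall T, F T -> (op_radius rho T <= k%:E)%E).
Proof. exact: family_equiv rho1 FZ FX Fmoebius K k. Qed.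

End fixed_size.

Lemma hom_cbnorm_cbradius K k : 1 <= K -> 1 <= k -> radius_rel rho K k ->
  (hom_cbnorm Phi <= K%:E)%E <-> (hom_cbradius Phi rho <= k%:E)%E.
Proof.
move=> K1 k1 rel; split=> /ereal_supP sup_le; apply/ereal_supP => _ [n n0 <-];
  apply/ereal_supP => _ [M M1 <-];
  have [NW WN] := ampliation_norm_radius n K1 k1 rel.
- apply: NW; last by exists M.
  move=> _ [N N1 <-]; have /ereal_supP := sup_le _ (ex_intro2 _ _ n n0 erefl).
  by apply; exists N.
- apply: WN; last by exists M.
  move=> _ [N N1 <-]; have /ereal_supP := sup_le _ (ex_intro2 _ _ n n0 erefl).
  by apply; exists N.
Qed.

Lemma hom_cbnorm_cbradius_dichotomy :
  ((1 <= hom_cbnorm Phi)%E /\ (1 <= hom_cbradius Phi rho)%E) \/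
  ((hom_cbnorm Phi < 1)%E /\ (hom_cbradius Phi rho < 1)%E).
Proof.
have [[x x0]|H0] := pselect (exists x : H, x != 0).
  have y0 : ([ffun=> x] : l2sum H 1) != 0.
    apply: contra x0 => /eqP/ffunP/(_ ord0); rewrite !ffunE => ->.
    exact: eqxx.
  have norm1 : opalg_mxnorm (1 : 'M[A]_1) <= 1.
    rewrite /opalg_mxnorm -/(amplify _ _) amplify1.
    by apply: opnorm_le => // f; rewrite mul1r.
  have amp1 : ampliation Phi (1 : 'M[A]_1) = 1 by exact: amplify1.
  left; split.
    apply: le_trans (ereal_sup_ubound (ex_intro2 _ _ 1%N isT erefl)).
    apply: le_trans (ereal_sup_ubound (ex_intro2 _ _ 1 norm1 erefl)).
    by rewrite amp1 lee_fin (nrm_bop1_ge y0).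
  apply: le_trans (ereal_sup_ubound (ex_intro2 _ _ 1%N isT erefl)).
  apply: le_trans (ereal_sup_ubound (ex_intro2 _ _ 1 norm1 erefl)).
  by rewrite amp1 (op_radius1_ge rho1 y0).
have {}H0 n (f : l2sum H n) : f = 0.
  apply/ffunP => i; rewrite [RHS]ffunE; apply: contrapT => /eqP x0.
  by apply: H0; exists (f i).
right; split.
  apply: (@le_lt_trans _ _ 0%:E); last by rewrite lte_fin.
  apply/ereal_supP => _ [n _ <-]; apply/ereal_supP => _ [M _ <-].
  by rewrite lee_fin (nrm_bop_trivial _ (@H0 n)).
apply: (@le_lt_trans _ _ (2^-1)%:E); last by rewrite lte_fin invf_lt1// ltr1n.
apply/ereal_supP => _ [n _ <-]; apply/ereal_supP => _ [M _ <-].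
by apply: op_radius_trivial => //; exact: H0.
Qed.

End opalg_families.

Theorem theorem3p2 (R : realType) (K rho : R) (hK : 1 <= K) (hrho : 1 <= rho) :
  let Kt := (K ^+ 2 + 1 +
               Num.sqrt ((K ^+ 2 + 1) ^+ 2 - 4 * rho * (2 - rho) * K ^+ 2))
            / (2 * rho * K) in
  (forall (A : banachAlgType R) (H : hilbertType R)
          (Phi : {lrmorphism A -> 'B(H)}),
     von_neumann_ineq A ->
     (hom_norm Phi = K%:E <-> hom_radius Phi rho = Kt%:E)) /\
  (forall (A : opAlg R) (H : hilbertType R)
          (Phi : {lrmorphism A -> 'B(H)}),
     (hom_cbnorm Phi = K%:E <-> hom_cbradius Phi rho = Kt%:E)).
Proof.
have [Kt1 rel] := radius_rel_radius hrho hK; move=> Kt; split=> [A H Phi vN|A H Phi].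
  apply: (radius_rel_sup hrho _ _ hK Kt1 rel).
    by move=> K' k'; exact: hom_norm_radius.
  exact: hom_norm_radius_dichotomy.
apply: (radius_rel_sup hrho _ _ hK Kt1 rel).
  by move=> K' k'; exact: hom_cbnorm_cbradius.
exact: hom_cbnorm_cbradius_dichotomy.
Qed.
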